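(* Suppose that $\Phi:\mathbb{R}^{d+1}\to\mathbb{R}^k$ and $V:\mathbb{R}^{d+1}\to\mathbb{R}$ are 2-homogeneous and that $R:\mathbb{R}^k\to\mathbb{R}$, $\Phi$, $V$ satisfy the regularity conditions in the context with parameters $M_R,C_R,B_\Phi,M_\Phi,b_V,B_V,M_V$. Let $L[\rho]=R\left(\int\Phi\,d\rho\right)+\int V\,d\rho$ for probability distributions $\rho$ on $\mathbb{R}^{d+1}$, and $L^\star=\inf_\rho L[\rho]$. Fix a desired error threshold $\epsilon>0$. Suppose that from a starting distribution $\rho_0$, a solution $(\rho_t)_{t\ge 0}$ to the perturbed Wasserstein gradient flow $$\frac{d}{dt}\rho_t=-\sigma\rho_t+\sigma U^d-\nabla\cdot(v[\rho_t]\rho_t)$$ exists, with $\sigma$ as chosen next. Choose $$\sigma=\exp\!\Big(-d\,\log(1/\epsilon)\;\mathrm{poly}\big(k,M_V,M_R,M_\Phi,b_V,B_V,C_R,B_\Phi,L[\rho_0]-L^\star\big)\Big),$$ $$t_\epsilon=\frac{d^2}{\epsilon^4}\;\mathrm{poly}\big(\log(1/\epsilon),k,M_V,M_R,M_\Phi,b_V,B_V,C_R,B_\Phi,L[\rho_0]-L^\star\big),$$ where each $\mathrm{poly}(\cdot)$ denotes a universal constant-degree polynomial in its arguments. Then it must hold that $$\min_{0\le t\le t_\epsilon}L[\rho_t]-\inf_\rho L[\rho]\le 2\epsilon .$$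
   Context: A function $h$ on $\mathbb{R}^{d+1}$ is 2-homogeneous if $h(c\theta)=c^2h(\theta)$ for any scalar $c$. $\mathbb{S}^d$ is the unit sphere of $\mathbb{R}^{d+1}$ and $U^d$ is the uniform probability distribution on $\mathbb{S}^d$. $\nabla\cdot$ denotes the divergence of a vector field. Regularity conditions: (1) $R$ is convex, nonnegative, Lipschitz and smooth, with $\|\nabla R\|_2\le M_R$ and $\|\nabla^2R\|_{op}\le C_R$. (2) $\Phi=(\Phi_1,\dots,\Phi_k)$ is differentiable, and bounded and Lipschitz on the sphere: $\|\Phi(\bar\theta)\|_2\le B_\Phi$ and $|\Phi_i(\bar\theta)-\Phi_i(\bar\theta')|\le M_\Phi\|\bar\theta-\bar\theta'\|_2$ for all $\bar\theta,\bar\theta'\in\mathbb{S}^d$ and all $i$. (3) $V$ is differentiable, and Lipschitz and upper and lower bounded on the sphere: $0<b_V\le V(\bar\theta)\le B_V$ and $\|\nabla V(\bar\theta)\|_2\le M_V$ for all $\bar\theta\in\mathbb{S}^d$. For a distribution $\rho$, define $L'[\rho](\theta)=\langle\nabla R(\int\Phi\,d\rho),\Phi(\theta)\rangle+V(\theta)$ and the velocity field $v[\rho](\theta)=-\nabla_\theta L'[\rho](\theta)$. (For infinite-width two-layer networks, $\rho$ is a distribution over the parameters of hidden units, $R$ is the loss and $V$ the regularizer.)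
   Formalization: As stated the claim fails; in the formal version both polynomials may also depend on 1/b_V and on L*, d ≥ 1 is assumed, and ε is restricted to 0 < ε ≤ ε₀ for an arbitrary fixed ε₀ < 1, on which the polynomials may depend. *)

(* Defs.v *)
From HB Require Import structures.
From mathcomp Require Import all_boot all_order all_algebra.
From mathcomp Require Import all_classical all_reals all_analysis.
(* [mpoly] is not imported: its notations clash with those of [analysis]. *)
From mathcomp Require mpoly.

Set Implicit Arguments.
Unset Strict Implicit.
Unset Printing Implicit Defensive.

Import Order.TTheory GRing.Theory Num.Theory.
Import numFieldNormedType.Exports.

Local Open Scope classical_set_scope.
Local Open Scope ring_scope.

(* The library norm [`|x|] on row vectors is the sup norm, which induces the
   same topology and the same notion of differentiability; every metric bound
   below uses the Euclidean norm [enorm] instead. *)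
Definition dot (R : realType) (n : nat) (x y : 'rV[R]_n) : R :=
  \sum_(i < n) x ord0 i * y ord0 i.

Definition enorm (R : realType) (n : nat) (x : 'rV[R]_n) : R :=
  Num.sqrt (dot x x).

Definition sphere (R : realType) (n : nat) : set 'rV[R]_n :=
  [set x | enorm x = 1].
Arguments sphere : clear implicits.

Definition grad (R : realType) (n : nat) (f : 'rV[R]_n -> R) (x : 'rV[R]_n)
    : 'rV[R]_n :=
  \row_(i < n) 'D_(delta_mx ord0 i) f x.

Definition homogeneous2 (R : realType) (n : nat) (W : lmodType R)
    (h : 'rV[R]_n -> W) : Prop :=
  forall (c : R) (x : 'rV[R]_n), h (c *: x) = c ^+ 2 *: h x.

(* R^n with its Borel sigma-algebra. *)
Notation borel_rV R n := (g_sigma_algebraType (@open 'rV[R]_n)).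

Definition distr (R : realType) (n : nat) := probability (borel_rV R n) R.

(* The uniform distribution on the unit sphere is the unique Borel probability
   measure that is carried by the sphere and invariant under the orthogonal
   group. *)
Definition uniform_on_sphere (R : realType) (n : nat) (U : distr R n) : Prop :=
  U (sphere R n) = 1%E /\
  forall Q : 'M[R]_n, Q *m Q^T = 1%:M ->
  forall A : set (borel_rV R n), measurable A ->
    U [set x : 'rV[R]_n | A (x *m Q)] = U A.

Section objective.
Variables (R : realType) (n k : nat).
Variables (Rf : 'rV[R]_k -> R) (Phi : 'rV[R]_n -> 'rV[R]_k) (V : 'rV[R]_n -> R).

(* [differentiable (grad Rf)] and ['d (grad Rf) y], the Hessian as a linear
   map, express that Rf is twice differentiable with bounded Hessian. *)
Record regularity (M_R C_R B_Phi M_Phi b_V B_V M_V : R) : Prop := Regularity {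
  reg_R_convex : convex_function setT (Rf : 'rV[R]_k -> R^o);
  reg_R_ge0 : forall y, 0 <= Rf y;
  reg_R_diff : forall y, differentiable Rf y;
  reg_R_diff2 : forall y, differentiable (grad Rf) y;
  reg_R_grad : forall y, enorm (grad Rf y) <= M_R;
  reg_R_hess : forall y u, enorm ('d (grad Rf) y u) <= C_R * enorm u;
  reg_Phi_diff : forall x, differentiable Phi x;
  reg_Phi_bound : forall x, sphere R n x -> enorm (Phi x) <= B_Phi;
  reg_Phi_lip : forall x y, sphere R n x -> sphere R n y -> forall i : 'I_k,
    `|Phi x ord0 i - Phi y ord0 i| <= M_Phi * enorm (x - y);
  reg_V_diff : forall x, differentiable V x;
  reg_b_V_gt0 : 0 < b_V;
  reg_V_bound : forall x, sphere R n x -> b_V <= V x <= B_V;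
  reg_V_grad : forall x, sphere R n x -> enorm (grad V x) <= M_V
}.

Definition meanPhi (rho : distr R n) : 'rV[R]_k :=
  \row_(i < k) (\int[rho]_x (Phi x ord0 i)).

(* Extended-real valued: under [regularity] and 2-homogeneity, V is nonnegative
   and dominates every |Phi_i| up to a constant, so that the value is +oo
   exactly when V is not rho-integrable, and otherwise [meanPhi] is a vector of
   genuine integrals. *)
Definition loss (rho : distr R n) : \bar R :=
  ((Rf (meanPhi rho))%:E + \int[rho]_x (V x)%:E)%E.

Definition loss_inf : \bar R := ereal_inf [set loss rho | rho in setT].

Definition dloss (rho : distr R n) (x : 'rV[R]_n) : R :=
  dot (grad Rf (meanPhi rho)) (Phi x) + V x.

Definition velocity (rho : distr R n) (x : 'rV[R]_n) : 'rV[R]_n :=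
  - grad (dloss rho) x.

(* Test functions for curves in the Wasserstein space of distributions with
   finite second moment: at most quadratic growth, with a gradient of at most
   linear growth (which implies the former). *)
Definition test_function (phi : 'rV[R]_n -> R) : Prop :=
  (forall x, differentiable phi x) /\
  exists C : R, forall x, enorm (grad phi x) <= C * (1 + enorm x).

(* Weak solutions of
     d/dt rho_t = - sigma rho_t + sigma U - div (v[rho_t] rho_t),   t >= 0,
   in the Wasserstein space.  Integration by parts turns the divergence term
   tested against phi into + \int <grad phi, v[rho_t]> d rho_t.  The values of
   rho at negative times are irrelevant. *)
Record perturbed_flow (sigma : R) (U : distr R n) (rho : R -> distr R n)
    : Prop := PerturbedFlow {
  flow_moment : forall t, 0 <= t ->
    (\int[rho t]_x ((enorm (x : 'rV[R]_n)) ^+ 2)%:E < +oo)%E;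
  flow_init : forall phi, test_function phi ->
    (fun t => \int[rho t]_x phi x) @ 0^'+ --> \int[rho 0]_x phi x;
  flow_eq : forall phi, test_function phi -> forall t : R, 0 < t ->
    is_derive t 1 (fun s => \int[rho s]_x phi x)
      (- sigma * (\int[rho t]_x phi x) + sigma * (\int[U]_x phi x)
       + \int[rho t]_x (dot (grad phi x) (velocity (rho t) x)))
}.

End objective.

(* The value of the polynomial p at the point s_0, ..., s_(n-1). *)
Definition poly_at (R : realType) (n : nat) (p : mpoly.mpoly n R) (s : seq R)
    : R :=
  mpoly.meval (fun i : 'I_n => s`_i) p.

(* Main.v *)
Require Import Defs.
From HB Require Import structures.
From mathcomp Require Import all_boot all_order all_algebra.
From mathcomp Require Import all_classical all_reals all_analysis.
From mathcomp Require mpoly.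
From mathcomp Require Import measurable_realfun ring lra.
Import Order.TTheory GRing.Theory Num.Theory.
Import numFieldNormedType.Exports.
Import (canonicals) mpoly.
Local Open Scope classical_set_scope.
Local Open Scope ring_scope.

(* Let [p_t] be the linearised loss [L'[rho_t]], a 2-homogeneous potential.  The
   energy identity makes [L[rho_t]] decrease at the rate of the dissipation
   [\int |grad p_t|^2 drho_t], up to a noise term of order [sigma].  If
   [L[rho_t]] exceeds the infimum by [2 eps], then either the dissipation is
   large, or by convexity [p_t < - tau] at some point of the sphere.  In the second
   case the noise puts a mass of at least [sigma tau ^ O(d)] around
   that point; as long as [p_t] has barely moved, 2-homogeneity makes the mass
   in directions where [p_t] is very negative grow like [expR (tau t)].  The
   second moment is bounded, so within time [O(log (1 / sigma) / tau)] the
   potential must move, and by Cauchy-Schwarz that costs a fixed amount of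
   dissipation.  Either way the loss drops by a fixed amount in a bounded time,
   which can happen only finitely often. *)

(** * Euclidean geometry and 2-homogeneous functions *)

(** The flow is given only by weak equations for fixed test functions, and [Phi] and [V] are merely
    differentiable, so no particle trajectories are available. Mass in bad directions is therefore
    measured by integrating the test function [well], which is 2-homogeneous, differentiable, and
    grows along the velocity field by Euler's identity. Since the potential drifts, the test
    function should drift too, which the weak equation does not allow. The way out: lower the
    threshold of the well so that it increases pointwise in time, differentiate only with the well
    frozen at the current time, and compare with an exponential by real induction.

    The constants run backwards. During a window [T1] the potential may move only by a fraction of
    [tau]; this fixes the Young parameter [lam], then the drop [Delta]. With [sigma = expR (- X)],
    the choice [T1 = 2 X / tau] makes the exponential growth equal to [sigma ^ -2]: one factor
    undoes the noise level, the other pays for the small mass of a spherical cap. Hence [X] is of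
    order [d ln (1 / eps)] times the parameters. *)

Section euclidean.
Context {R : realType} {n : nat}.
Implicit Types (x y z : 'rV[R]_n) (c : R).

Lemma dotC x y : dot x y = dot y x.
Proof. by apply: eq_bigr => i _; rewrite mulrC. Qed.

Lemma dotDl x y z : dot (x + y) z = dot x z + dot y z.
Proof. by rewrite -big_split/=; apply: eq_bigr => i _; rewrite mxE mulrDl. Qed.

Lemma dotDr x y z : dot x (y + z) = dot x y + dot x z.
Proof. by rewrite !(dotC x) dotDl. Qed.

Lemma dotZl c x y : dot (c *: x) y = c * dot x y.
Proof. by rewrite mulr_sumr; apply: eq_bigr => i _; rewrite mxE mulrA. Qed.

Lemma dotZr c x y : dot x (c *: y) = c * dot x y.
Proof. by rewrite dotC dotZl dotC. Qed.

Lemma dotNl x y : dot (- x) y = - dot x y.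
Proof. by rewrite -scaleN1r dotZl mulN1r. Qed.

Lemma dotNr x y : dot x (- y) = - dot x y.
Proof. by rewrite dotC dotNl dotC. Qed.

Lemma dotBl x y z : dot (x - y) z = dot x z - dot y z.
Proof. by rewrite dotDl dotNl. Qed.

Lemma dotBr x y z : dot x (y - z) = dot x y - dot x z.
Proof. by rewrite dotDr dotNr. Qed.

Lemma dot0l x : dot 0 x = 0.
Proof. by rewrite -(scale0r (0 : 'rV[R]_n)) dotZl mul0r. Qed.

Lemma dot0r x : dot x 0 = 0.
Proof. by rewrite dotC dot0l. Qed.

Lemma dot_ge0 x : 0 <= dot x x.
Proof. by apply: sumr_ge0 => i _; rewrite -expr2 sqr_ge0. Qed.

Lemma dot_eq0 x : (dot x x == 0) = (x == 0).
Proof.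
apply/idP/eqP => [|->]; last by rewrite dot0l.
rewrite psumr_eq0; last by move=> i _; rewrite -expr2 sqr_ge0.
move=> /allP h; apply/rowP => i; rewrite mxE.
by apply/eqP; have /(_ (mem_index_enum _))/implyP/(_ isT) := h i; rewrite mulf_eq0 orbb.
Qed.

Lemma dot_gt0 x : (0 < dot x x) = (x != 0).
Proof. by rewrite lt_def dot_ge0 andbT dot_eq0. Qed.

Lemma enorm_ge0 x : 0 <= enorm x.
Proof. exact: sqrtr_ge0. Qed.

Lemma sqr_enorm x : enorm x ^+ 2 = dot x x.
Proof. by rewrite sqr_sqrtr// dot_ge0. Qed.

Lemma enorm0 : enorm (0 : 'rV[R]_n) = 0.
Proof. by rewrite /enorm dot0l sqrtr0. Qed.

Lemma enorm_eq0 x : (enorm x == 0) = (x == 0).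
Proof.
have -> : (enorm x == 0) = (enorm x ^+ 2 == 0) by rewrite expf_eq0.
by rewrite sqr_enorm dot_eq0.
Qed.

Lemma enormZ c x : enorm (c *: x) = `|c| * enorm x.
Proof. by rewrite /enorm dotZl dotZr mulrA -expr2 sqrtrM ?sqr_ge0// sqrtr_sqr. Qed.

Lemma enormN x : enorm (- x) = enorm x.
Proof. by rewrite -scaleN1r enormZ normrN1 mul1r. Qed.

Lemma sphere_dot x : sphere R n x <-> dot x x = 1.
Proof.
split=> [h|h]; first by rewrite -sqr_enorm h expr1n.
by rewrite /sphere/= /enorm h sqrtr1.
Qed.

Lemma sphere_normalize x : x != 0 -> sphere R n ((enorm x)^-1 *: x).
Proof.
move=> x0; rewrite /sphere/= enormZ ger0_norm ?invr_ge0 ?enorm_ge0//.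
by rewrite mulVf// enorm_eq0.
Qed.

Lemma dot_sqr_le x y : dot x y ^+ 2 <= dot x x * dot y y.
Proof.
have [->|y0] := eqVneq y 0; first by rewrite !dot0r expr0n mulr0.
have := dot_ge0 (dot y y *: x - dot x y *: y).
rewrite dotBl !dotBr !dotZl !dotZr (dotC y x).
have -> : dot y y * (dot y y * dot x x) - dot y y * (dot x y * dot x y)
  - (dot x y * (dot y y * dot x y) - dot x y * (dot x y * dot y y))
  = dot y y * (dot x x * dot y y - dot x y ^+ 2) by ring.
by rewrite pmulr_rge0 ?dot_gt0// subr_ge0.
Qed.

Lemma cauchy_schwarz x y : `|dot x y| <= enorm x * enorm y.
Proof.
rewrite -(@ler_pXn2r _ 2)// ?nnegrE ?mulr_ge0 ?enorm_ge0//.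
by rewrite exprMn !sqr_enorm real_normK ?num_real// dot_sqr_le.
Qed.

Lemma enorm_coord x i : `|x ord0 i| <= enorm x.
Proof.
rewrite -(@ler_pXn2r _ 2)// ?nnegrE ?enorm_ge0// real_normK ?num_real//.
rewrite sqr_enorm /dot (bigD1 i)//= expr2 lerDl sumr_ge0// => j _.
by rewrite -expr2 sqr_ge0.
Qed.

(** Reduces a Euclidean bound on a vector to scalar functions [dot u _], to which the mean value
    theorem applies. The sign condition covers [x = 0]. *)
Lemma enorm_le_dual x c : (forall u, enorm u = 1 -> dot u x <= c) -> 0 <= c ->
  enorm x <= c.
Proof.
move=> h c0; have [->|x0] := eqVneq x 0; first by rewrite enorm0.
have := h _ (sphere_normalize x x0); rewrite dotZl -sqr_enorm expr2 mulrA mulVf ?enorm_eq0//.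
by rewrite mul1r.
Qed.

Lemma dot_delta x i : dot x (delta_mx ord0 i) = x ord0 i.
Proof.
rewrite /dot (bigD1 i)//= mxE !eqxx mulr1 big1 ?addr0// => j ji.
by rewrite mxE eqxx (negPf ji) mulr0.
Qed.

Lemma dot_young x y c : 0 < c ->
  dot x y <= (c * dot x x + c^-1 * dot y y) / 2.
Proof.
move=> c0; have := dot_ge0 (c *: x - y).
rewrite dotBl !dotBr !dotZl !dotZr (dotC y x) => h.
have -> : (c * dot x x + c^-1 * dot y y) / 2 = c^-1 * (c * (c * dot x x) + dot y y) / 2.
  by field; rewrite gt_eqF.
rewrite ler_pdivlMr// ler_pdivlMl//; lra.
Qed.

Lemma enormD x y : enorm (x + y) <= enorm x + enorm y.
Proof.
rewrite -(@ler_pXn2r _ 2) ?nnegrE ?addr_ge0 ?enorm_ge0// sqrrD !sqr_enorm.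
rewrite dotDl !dotDr (dotC y x).
have := le_trans (ler_norm _) (cauchy_schwarz x y); rewrite mulr2n; lra.
Qed.

End euclidean.

(** * Gradients and comparison along segments *)

Section gradients.
Context {R : realType} {n : nat}.
Implicit Types (f g : 'rV[R]_n -> R) (x u : 'rV[R]_n).

Lemma diff_grad f x u : differentiable f x -> 'd f x u = dot (grad f x) u.
Proof.
move=> df; rewrite {1}(row_sum_delta u) linear_sum /dot; apply: eq_bigr => i _.
by rewrite linearZ/= mxE deriveE// mulrC.
Qed.

Lemma grad_unique f x (y : 'rV[R]_n) : differentiable f x ->
  (forall u, 'd f x u = dot y u) -> grad f x = y.
Proof.
move=> df h; apply/rowP => i.
by rewrite -dot_delta -diff_grad// h dot_delta.
Qed.


Lemma is_derive_line {W : normedModType R} (f : 'rV[R]_n -> W) x u (s : R) :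
  differentiable f (x + s *: u) ->
  is_derive s 1 (fun s : R => f (x + s *: u)) ('d f (x + s *: u) u).
Proof.
move=> df; set y := x + s *: u; set g := fun s : R => f (x + s *: u).
have E : (fun h : R => h^-1 *: ((g \o shift s) (h *: (1 : R)) - g s)) =
         (fun h : R => h^-1 *: ((f \o shift y) (h *: u) - f y)).
  apply/funext => h; congr (_ *: (f _ - _)).
  by rewrite /= [_ *: 1]mulr1 scalerDl addrCA.
apply: DeriveDef; first by rewrite /derivable E; exact: diff_derivable.
by rewrite /derive E -/('D_u f y) deriveE.
Qed.

(** All that a derivative at a single point yields: growth relative to [F t] just after [t], without
    monotonicity nearby. It drives the contradiction arguments on rays and the forward step of the
    real induction. *)
Lemma is_derive_right_gt (F : R -> R) (t l : R) : is_derive t 1 F l -> 0 < l ->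
  exists2 e, 0 < e & forall s, t < s < t + e -> F t < F s.
Proof.
move=> dF l0; have := @ex_derive _ _ _ _ _ _ _ dF.
rewrite /derivable => /cvg_ex[/= l' hl'].
have ll' : l = l'.
  by rewrite -(@derive_val _ _ _ _ _ _ _ dF); apply/cvg_lim.
rewrite -{}ll' in hl'.
have /cvgrPdist_lt/(_ _ l0) := hl'.
rewrite near_withinE near_nbhs => -[e/= e0 he].
exists e => // s /andP[ts se].
have /he : ball_ [eta Num.Def.normr] 0 e (s - t).
  by rewrite /= sub0r normrN gtr0_norm; lra.
rewrite subr_eq0 gt_eqF// => /(_ isT).
rewrite /= [_ *: 1]mulr1 subrK -[_ *: _]/((s - t)^-1 * (F s - F t)).
rewrite ltr_norml => /andP[_]; rewrite ltrBlDl -ltrBlDr subrr.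
by rewrite pmulr_rgt0 ?invr_gt0 ?subr_gt0.
Qed.

Lemma le_of_derive_le (F dF : R -> R) (a b c : R) : a <= b ->
  (forall x : R, a < x < b -> is_derive x 1 F (dF x)) ->
  {within `[a, b], continuous F} ->
  (forall x : R, a < x < b -> dF x <= c) -> F b - F a <= c * (b - a).
Proof.
rewrite le_eqVlt => /predU1P[-> *|ab hF cF hc]; first by rewrite !subrr mulr0.
have hF' (x : R) : x \in `]a, b[ -> is_derive x 1 F (dF x).
  by rewrite in_itv/= => /hF.
have [x] := @MVT R F dF a b ab hF' cF.
by rewrite in_itv/= => /hc h ->; rewrite ler_wpM2r// subr_ge0 ltW.
Qed.

Lemma le_segment f x y (c : R) : (forall z, differentiable f z) ->
  (forall s, 0 < s < 1 -> 'd f (x + s *: (y - x)) (y - x) <= c) ->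
  f y - f x <= c.
Proof.
move=> df h.
have := @le_of_derive_le (fun s => f (x + s *: (y - x)))
  (fun s => 'd f (x + s *: (y - x)) (y - x)) 0 1 c ler01.
rewrite scale1r scale0r addr0 subr0 mulr1 addrCA subrr addr0; apply => //.
- by move=> s _; apply: is_derive_line.
- apply: derivable_within_continuous => s _.
  by have := is_derive_line f x (y - x) s (df _) => /@ex_derive.
Qed.

End gradients.

(** * Gradients of 2-homogeneous functions *)

Section homogeneous.
Context {R : realType} {n : nat} (h : 'rV[R]_n -> R).
Hypotheses (hom : homogeneous2 (h : 'rV[R]_n -> R^o)).
Hypothesis (dh : forall x, differentiable h x).
Implicit Types (x u : 'rV[R]_n).

Lemma homE (c : R) x : h (c *: x) = c ^+ 2 * h x.
Proof. exact: hom. Qed.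

Lemma hom0 : h 0 = 0.
Proof. by rewrite -(scale0r (0 : 'rV[R]_n)) homE expr0n mul0r. Qed.


Lemma is_derive_quadratic (a b c s : R) :
  is_derive s 1 (fun s : R => a + b * s + c * s ^+ 2) (b + 2 * c * s).
Proof.
rewrite -[fun s => _]/(cst a + (b \*: id) + (c \*: (id ^+ 2)) : R -> R).
apply: is_derive_eq; rewrite /GRing.scale/=; ring.
Qed.

(** For [c != 0], differentiating [h (c x + s c u) = c ^ 2 h (x + s u)] at [s = 0] gives [c] times
    the claim; for [c = 0], the function [h (s u) = s ^ 2 h u] has derivative 0 at 0. *)
Lemma derive_homZ (c : R) x u : 'd h (c *: x) u = c * 'd h x u.
Proof.
have [->|c0] := eqVneq c 0.
  rewrite scale0r mul0r; have := is_derive_line h 0 u 0 (dh _).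
  rewrite scale0r addr0 => /@derive_val <-.
  have -> : (fun s : R => h (0 + s *: u)) = (fun s => 0 + 0 * s + h u * s ^+ 2).
    by apply/funext => s; rewrite add0r homE; ring.
  by rewrite (@derive_val _ _ _ _ _ _ _ (is_derive_quadratic _ _ _ _)); ring.
have h1 := is_derive_line h (c *: x) (c *: u) 0 (dh _).
have h2 := is_derive_line h x u 0 (dh _).
rewrite !scale0r !addr0 in h1 h2.
have : is_derive (0:R) 1 (c ^+ 2 \*: (fun s : R => h (x + s *: u)))
  (c ^+ 2 *: 'd h x u) by apply: is_derive_eq.
have -> : (c ^+ 2 \*: (fun s : R => h (x + s *: u))) =
   (fun s : R => h (c *: x + s *: (c *: u))).
  apply/funext => s; rewrite -[LHS]/(c ^+ 2 * h _) -homE; congr h.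
  by rewrite scalerDr !scalerA mulrC.
move=> /@derive_val e2; have /@derive_val e1 := h1.
have L : 'd h (c *: x) (c *: u) = c * 'd h (c *: x) u by exact: linearZ.
have e3 := etrans (esym L) (etrans (esym e1) e2).
by apply: (mulfI c0); rewrite [LHS]e3; exact: (esym (mulrA c c _)).
Qed.

Lemma euler_hom x : 'd h x x = 2 * h x.
Proof.
have := is_derive_line h x x 0 (dh _).
rewrite scale0r addr0 => /@derive_val <-.
have -> : (fun s : R => h (x + s *: x)) = (fun s => h x + 2 * h x * s + h x * s ^+ 2).
  by apply/funext => s; rewrite -{1}(scale1r x) -scalerDl homE; ring.
by rewrite (@derive_val _ _ _ _ _ _ _ (is_derive_quadratic _ _ _ _)); ring.
Qed.

Lemma grad_homZ (c : R) x : grad h (c *: x) = c *: grad h x.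
Proof.
by apply: grad_unique => // u; rewrite derive_homZ dotZl diff_grad.
Qed.

Lemma hom_le_sphere (c : R) x : (forall y, sphere R n y -> `|h y| <= c) ->
  `|h x| <= c * dot x x.
Proof.
move=> hc; have [->|x0] := eqVneq x 0; first by rewrite hom0 normr0 dot0l mulr0.
have e0 : 0 < enorm x by rewrite lt_def enorm_ge0 enorm_eq0 x0.
have -> : x = enorm x *: ((enorm x)^-1 *: x).
  by rewrite scalerA divff ?scale1r// gt_eqF.
rewrite homE dotZl dotZr (sphere_dot _).1; last exact: sphere_normalize.
rewrite normrM ger0_norm ?sqr_ge0// mulr1 mulrC -expr2 ler_wpM2r ?sqr_ge0//.
exact/hc/sphere_normalize.
Qed.

Lemma grad_le_sphere (c : R) x :
  (forall y, sphere R n y -> enorm (grad h y) <= c) ->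
  enorm (grad h x) <= c * enorm x.
Proof.
move=> hc; have [->|x0] := eqVneq x 0.
  by rewrite -(scale0r (0 : 'rV[R]_n)) grad_homZ !scale0r enorm0 mulr0.
have e0 : 0 < enorm x by rewrite lt_def enorm_ge0 enorm_eq0 x0.
rewrite -{1}[x]scale1r -(@divff _ (enorm x)) ?gt_eqF// -scalerA grad_homZ enormZ.
by rewrite gtr0_norm// mulrC ler_wpM2r ?enorm_ge0//; apply/hc/sphere_normalize.
Qed.

(* Along a ray from a point of the sphere, compare with the value at the
   radial projection [y] of [x + s u]: [|y - x|^2 <= s^2 |u|^2 / |x + s u|]. *)
Lemma grad_le_lipschitz (B L : R) x :
  (forall y, sphere R n y -> `|h y| <= B) -> 0 <= L ->
  (forall y z, sphere R n y -> sphere R n z -> `|h y - h z| <= L * enorm (y - z)) ->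
  enorm (grad h x) <= 2 * (B + L) * enorm x.
Proof.
move=> hB L0 hL; apply: grad_le_sphere => {}x xS.
have B0 : 0 <= B by apply: le_trans (hB _ xS).
apply: enorm_le_dual => [u u1|]; last by rewrite mulr_ge0// addr_ge0.
rewrite dotC -diff_grad//; rewrite leNgt; apply/negP => lt.
have D1 := is_derive_line h x u 0 (dh _).
rewrite scale0r addr0 in D1.
(* The slope at 0 is the claimed bound; the term [B s ^ 2] absorbs the second-order error of the
   expansion below. *)
have D2 := is_derive_quadratic 0 (2 * (B + L)) B 0.
have := is_derive_right_gt _ _ _ (@is_deriveB _ _ _ _ _ _ _ _ _ D1 D2).
rewrite mulr0 addr0 subr_gt0 => /(_ lt)[e e0].
(* [s <= 1 / 8] keeps [y] at distance at least 1/2 from the origin, so that its radial projection is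
   within [2 s] of [x]. *)
set s : R := Num.min (e / 2) (1 / 8).
have s0 : 0 < s by rewrite lt_min; apply/andP; split; lra.
have se : s < e by rewrite gt_min; apply/orP; left; lra.
have s8 : s <= 1 / 8 by rewrite ge_min lexx orbT.
move=> /(_ s); rewrite add0r s0 se => /(_ isT).
rewrite -![(_ - _ : _ -> _) _]/(_ - _)/= scale0r addr0 expr0n/= !mulr0 !addr0 subr0.
rewrite add0r; set y := x + s *: u => H.
have xu : `|dot x u| <= 1.
  by rewrite (le_trans (cauchy_schwarz _ _))// xS u1 mulr1.
have xx : dot x x = 1 by apply/sphere_dot.
have uu : dot u u = 1 by apply/sphere_dot.
have yy : dot y y = 1 + 2 * s * dot x u + s ^+ 2.
  rewrite /y dotDl !dotDr !dotZl !dotZr xx uu (dotC u x); ring.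
have yx : dot y x = 1 + s * dot x u by rewrite /y dotDl dotZl xx dotC.
have yy4 : (1 / 2) ^+ 2 <= dot y y.
  rewrite yy; move: xu; rewrite ler_norml => /andP[? ?].
  have : - s <= s * dot x u by rewrite -mulrN1 ler_pM2l.
  have := sqr_ge0 s; rewrite expr2; lra.
have y4 : 1 / 2 <= enorm y by rewrite -(@ler_pXn2r _ 2) ?nnegrE ?enorm_ge0 ?sqr_enorm//; lra.
have y0 : 0 < enorm y by lra.
have yn0 : y != 0 by rewrite -enorm_eq0 gt_eqF.
set z := (enorm y)^-1 *: y.
have zS : sphere R n z by exact: sphere_normalize.
have hyz : h y = dot y y * h z.
  by rewrite /z homE -sqr_enorm mulrA -exprMn divff ?gt_eqF// expr1n mul1r.
have zx : enorm (z - x) <= 2 * s.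
  rewrite -(@ler_pXn2r _ 2) ?nnegrE ?enorm_ge0//; last by rewrite mulr_ge0// ltW.
  have -> : enorm (z - x) ^+ 2 = 2 - 2 * dot y x / enorm y.
    rewrite sqr_enorm dotBl !dotBr xx (sphere_dot z).1// (dotC x z) /z dotZl; field.
    by rewrite gt_eqF.
  have -> : 2 - 2 * dot y x / enorm y = (2 * enorm y - 2 * dot y x) / enorm y.
    by field; rewrite gt_eqF.
  rewrite ler_pdivrMr//.
  have h1 : 2 * enorm y - 2 * dot y x <= s ^+ 2.
    have := sqr_ge0 (enorm y - 1); rewrite sqrrB1 sqr_enorm yx yy mulr2n; lra.
  apply: (le_trans h1); rewrite exprMn -mulrA mulrCA.
  rewrite -{1}[s ^+ 2]mulr1 ler_pM2l ?exprn_gt0//; lra.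
have : h y - h x <= 2 * (B + L) * s + B * s ^+ 2.
  have -> : h y - h x = (dot y y - 1) * h z + (h z - h x) by rewrite hyz; ring.
  have k1 := hL _ _ zS xS.
  have k2 : h z - h x <= 2 * L * s.
    rewrite (le_trans (ler_norm _))// (le_trans k1)// -mulrA mulrCA.
    by rewrite ler_wpM2l.
  have k3 : (dot y y - 1) * h z <= (2 * s + s ^+ 2) * B.
    rewrite (le_trans (ler_norm _))// normrM ler_pM// ?hB//.
    rewrite yy addrAC [1 + _]addrC addrK ler_norml.
    move: xu; rewrite ler_norml => /andP[? ?].
    have : - s <= s * dot x u by rewrite -mulrN1 ler_pM2l.
    have : s * dot x u <= s by rewrite -{2}[s]mulr1 ler_pM2l.
    have := sqr_ge0 s.
    by move=> ? ? ?; apply/andP; split; lra.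
  lra.
by move: H; lra.
Qed.

(* The segment between two points of the sphere stays in the unit ball, where
   the 1-homogeneous gradient is no larger than on the sphere. *)
Lemma lipschitz_le_grad (L : R) x y :
  (forall z, sphere R n z -> enorm (grad h z) <= L) ->
  sphere R n x -> sphere R n y -> h y - h x <= L * enorm (y - x).
Proof.
move=> hL xS yS; apply: le_segment => // s /andP[s0 s1].
rewrite diff_grad// (le_trans (ler_norm _))// (le_trans (cauchy_schwarz _ _))//.
rewrite ler_wpM2r ?enorm_ge0// (le_trans (grad_le_sphere _ _ hL))//.
have L0 : 0 <= L by apply: le_trans (hL _ xS); rewrite enorm_ge0.
rewrite -{2}[L]mulr1 ler_wpM2l//.
rewrite -(@ler_pXn2r _ 2) ?nnegrE ?enorm_ge0// sqr_enorm expr1n.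
have xx : dot x x = 1 by apply/sphere_dot.
have yy : dot y y = 1 by apply/sphere_dot.
have xy : dot x y <= 1.
  by rewrite (le_trans (ler_norm _))// (le_trans (cauchy_schwarz _ _))// xS yS mulr1.
rewrite dotDl !dotDr !dotZl !dotZr !dotBl !dotBr xx yy (dotC y x).
have : 0 <= s * (1 - s) * (1 - dot x y) by rewrite !mulr_ge0 ?subr_ge0// ltW.
lra.
Qed.

End homogeneous.

(** * Functions of quadratic growth *)

Section measurability.
Context {R : realType} {n : nat}.
Implicit Types (f g : 'rV[R]_n -> R) (x u : 'rV[R]_n).

Definition meas f := measurable_fun setT (f : borel_rV R n -> R).

Lemma continuous_meas f : continuous f -> meas f.
Proof.
move=> /continuousP cf; apply: (measurability _ (RGenOpens.measurableE R)).
move=> _ [_ [a [b ->] <-]]; rewrite setTI.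
by apply: sub_sigma_algebra; apply: cf; exact: interval_open.
Qed.

Lemma continuous_addl (a : 'rV[R]_n) : continuous (fun x : 'rV[R]_n => a + x).
Proof.
move=> x A /nbhs_ballP[e e0 eA]; apply/nbhs_ballP; exists e => // y xy.
apply: eA; move: xy; rewrite -!ball_normE /ball_/=.
by rewrite opprD addrACA subrr add0r.
Qed.

Lemma differentiable_meas f : (forall x, differentiable f x) -> meas f.
Proof. by move=> df; apply: continuous_meas => x; exact: differentiable_continuous. Qed.

Lemma measD f g : meas f -> meas g -> meas (fun x => f x + g x).
Proof. exact: measurable_funD. Qed.

Lemma measM f g : meas f -> meas g -> meas (fun x => f x * g x).
Proof. exact: measurable_funM. Qed.

Lemma meas_cst c : meas (fun=> c).
Proof. exact: measurable_cst. Qed.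

(** A gradient need not be continuous; a directional derivative is measurable as the pointwise limit
    of continuous difference quotients with steps [1 / (i + 1)]. *)
Lemma meas_diff f u : (forall x, differentiable f x) -> meas (fun x => 'd f x u).
Proof.
move=> df; set h := fun (i : nat) x => i.+1%:R * (f (i.+1%:R^-1 *: u + x) - f x).
apply: (@measurable_fun_cvg _ (borel_rV R n) R setT h) => //.
  move=> i; apply: measM; first exact: meas_cst.
  apply: continuous_meas => x; apply: continuousB; last exact: differentiable_continuous.
  apply: continuous_comp; last exact: differentiable_continuous.
  exact: continuous_addl.
move=> x _; have := @diff_derivable _ _ _ f x u (df x); rewrite -deriveE//.
rewrite /derivable /derive => c.
rewrite (_ : h ^~ x = (fun s : R => s^-1 *: ((f \o shift x) (s *: u) - f x)) \o
   (fun i : nat => i.+1%:R^-1)); last first.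
  by apply/funext => i; rewrite /h/= invrK.
apply: (cvg_comp _ _ _ c) => A; have /= := @cvg_harmonic R => c0 /c0 h0.
have {}h0 : \forall i \near \oo, (@harmonic R i != 0 -> A (@harmonic R i)) := h0.
by apply: filterS h0 => i; apply; rewrite /harmonic invr_eq0 pnatr_eq0.
Qed.

Lemma meas_grad f i : (forall x, differentiable f x) ->
  meas (fun x => grad f x ord0 i).
Proof.
move=> df; rewrite (_ : (fun x => _) = (fun x => 'd f x (delta_mx ord0 i))).
  exact: meas_diff.
by apply/funext => x; rewrite diff_grad// dot_delta.
Qed.

Lemma meas_dot (v w : 'rV[R]_n -> 'rV[R]_n) :
  (forall i, meas (fun x => v x ord0 i)) -> (forall i, meas (fun x => w x ord0 i)) ->
  meas (fun x => dot (v x) (w x)).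
Proof.
move=> mv mw; apply: (@measurable_sum _ (borel_rV R n)) => i.
exact: measM.
Qed.

Lemma meas_norm2 : meas (fun x => dot x x).
Proof.
by apply: meas_dot => i; apply: continuous_meas => x; exact: coord_continuous.
Qed.

End measurability.

(* Functions whose integral is finite against every distribution with a second
   moment. *)
Definition quadratic {R : realType} {n : nat} (f : 'rV[R]_n -> R) :=
  meas f /\ exists c : R, forall x, `|f x| <= c * dot x x.

Definition moment2 {R : realType} {n : nat} (rho : distr R n) : Prop :=
  (\int[rho]_x ((enorm (x : 'rV[R]_n)) ^+ 2)%:E < +oo)%E.

Definition expect {R : realType} {n : nat} (rho : distr R n) (f : 'rV[R]_n -> R) : R :=
  \int[rho]_x f x.

Section expectation.
Context {R : realType} {n : nat}.
Implicit Types (f g : 'rV[R]_n -> R) (x u : 'rV[R]_n) (rho : distr R n).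

Lemma quadratic_norm2 : quadratic (fun x : 'rV[R]_n => dot x x).
Proof.
split; first exact: meas_norm2.
by exists 1 => x; rewrite mul1r ger0_norm ?dot_ge0.
Qed.

Lemma quadraticD f g : quadratic f -> quadratic g -> quadratic (fun x => f x + g x).
Proof.
move=> [mf [a fa]] [mg [b gb]]; split; first exact: measD.
by exists (a + b) => x; rewrite mulrDl (le_trans (ler_normD _ _))// lerD.
Qed.

Lemma quadraticZ (c : R) f : quadratic f -> quadratic (fun x => c * f x).
Proof.
move=> [mf [a fa]]; split; first by apply: measM => //; exact: meas_cst.
by exists (`|c| * a) => x; rewrite normrM -mulrA ler_wpM2l.
Qed.

Lemma quadratic_integrable rho f : moment2 rho -> quadratic f ->
  rho.-integrable setT (EFin \o f).
Proof.
move=> m2 [mf [c fc]].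
apply: (@le_integrable _ (borel_rV R n) R rho setT measurableT (EFin \o f)
  (fun x => c%:E * (dot (x : 'rV[R]_n) x)%:E)%E).
- exact/measurable_EFinP.
- by move=> x _; rewrite -EFinM [leRHS]/= [leLHS]/= lee_fin (le_trans (fc x))// ler_norm.
apply: integrableZl => //; apply/integrableP; split.
  by apply/measurable_EFinP; exact: meas_norm2.
apply: le_lt_trans m2; rewrite le_eqVlt; apply/orP; left; apply/eqP.
by apply: eq_integral => x _; rewrite sqr_enorm/= ger0_norm// dot_ge0.
Qed.

Lemma expectD rho f g : moment2 rho -> quadratic f -> quadratic g ->
  expect rho (fun x => f x + g x) = expect rho f + expect rho g.
Proof. by move=> m2 qf qg; apply: RintegralD => //; exact: quadratic_integrable. Qed.

Lemma expectZ rho (c : R) f : moment2 rho -> quadratic f ->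
  expect rho (fun x => c * f x) = c * expect rho f.
Proof. by move=> m2 qf; apply: RintegralZl => //; exact: quadratic_integrable. Qed.

Lemma expect_sum rho {m : nat} (F : 'I_m -> 'rV[R]_n -> R) : moment2 rho ->
  (forall i, quadratic (F i)) ->
  quadratic (fun x => \sum_(i < m) F i x) /\
  expect rho (fun x => \sum_(i < m) F i x) = \sum_(i < m) expect rho (F i).
Proof.
move=> m2; elim: m F => [|m IH] F qF.
  split.
    split; last by exists 0 => x; rewrite big_ord0 normr0 mul0r.
    by rewrite /meas (_ : (fun x => _) = cst 0)//; apply/funext => x; rewrite big_ord0.
  rewrite big_ord0 /expect (_ : (fun x => _) = cst 0) ?Rintegral_cst// ?mul0r//.
  by apply/funext => x; rewrite big_ord0.
have [q e] := IH (fun i => F (widen_ord (leqnSn m) i)) (fun i => qF _).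
under [fun x => \sum_(_ < _) _]eq_fun do rewrite big_ord_recr/=.
rewrite big_ord_recr/= -e -expectD//.
by split => //; apply: quadraticD.
Qed.

Lemma expect_le rho f g : moment2 rho -> quadratic f -> quadratic g ->
  (forall x, f x <= g x) -> expect rho f <= expect rho g.
Proof.
by move=> m2 qf qg fg; apply: le_Rintegral => //; exact: quadratic_integrable.
Qed.

Lemma expect_ge0 rho f : (forall x, 0 <= f x) -> 0 <= expect rho f.
Proof. by move=> f0; apply: Rintegral_ge0. Qed.

Lemma expectE rho f : moment2 rho -> quadratic f ->
  (\int[rho]_x (f x)%:E)%E = (expect rho f)%:E.
Proof.
move=> m2 qf; rewrite fineK//; apply: integrable_fin_num => //.
exact: quadratic_integrable.
Qed.

Lemma quadratic_bound f (c : R) : meas f -> (forall x, `|f x| <= c * dot x x) -> quadratic f.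
Proof. by move=> mf fc; split=> //; exists c. Qed.

Lemma expect_norm_le rho f (c : R) : moment2 rho -> meas f ->
  (forall x, `|f x| <= c * dot x x) ->
  `|expect rho f| <= c * expect rho (fun x => dot x x).
Proof.
move=> m2 mf fc; have qf : quadratic f by apply: quadratic_bound fc.
have qc := quadraticZ c _ quadratic_norm2.
rewrite -expectZ//; last exact: quadratic_norm2.
rewrite ler_norml; apply/andP; split; last first.
  by apply: expect_le => // x; rewrite (le_trans (ler_norm _)).
rewrite -mulN1r -expectZ//; apply: expect_le => //; first exact: quadraticZ.
by move=> x; rewrite mulN1r lerNl (le_trans _ (fc x))// -normrN ler_norm.
Qed.

Lemma expect_ge_set rho f (c : R) (A : set (borel_rV R n)) : moment2 rho -> quadratic f ->
  measurable A -> (forall x, 0 <= f x) -> 0 <= c -> (forall x, A x -> c <= f x) ->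
  (c%:E * rho A <= (expect rho f)%:E)%E.
Proof.
move=> m2 qf mA f0 c0 cf; rewrite -expectE//.
rewrite -integral_cst//.
apply: (@le_trans _ _ (\int[rho]_(x in A) (f x)%:E)%E).
  apply: ge0_le_integral => //=; rewrite ?lee_fin//.
  - by apply/measurable_EFinP; apply: measurable_funTS; exact: qf.1.
apply: ge0_subset_integral => //=.
- by apply/measurable_EFinP; exact: qf.1.
- by move=> x _; rewrite lee_fin.
Qed.

End expectation.

(** * The uniform measure of spherical caps *)

Section rotation.
Context {R : realType} {n : nat}.
Implicit Types (x y u : 'rV[R]_n).

Lemma dot_mulmx x y : dot x y = (x *m y^T) ord0 ord0.
Proof. by rewrite mxE; apply: eq_bigr => i _; rewrite mxE. Qed.

Lemma dot_orthogonal (Q : 'M[R]_n) x y : Q *m Q^T = 1%:M ->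
  dot (x *m Q) (y *m Q) = dot x y.
Proof. by move=> QQ; rewrite !dot_mulmx trmx_mul mulmxA -(mulmxA x) QQ mulmx1. Qed.

(** The Householder reflection along [w = x - y] exchanges [x] and [y]. Its matrix [1 - W] is
    symmetric and [W ^ 2 = 2 W], so it is its own inverse; [2 dot x w = dot w w] because both points
    are unit vectors. *)
Lemma orthogonal_transitive x y : sphere R n x -> sphere R n y ->
  exists2 Q : 'M[R]_n, Q *m Q^T = 1%:M & x *m Q = y.
Proof.
move=> /sphere_dot xx /sphere_dot yy.
have [->|xy] := eqVneq x y; first by exists 1%:M; rewrite ?trmx1 mulmx1.
set w := x - y; have ww : dot w w != 0 by rewrite dot_eq0 subr_eq0.
set c := 2 / dot w w.
set W := c *: (w^T *m w).
have WT : W^T = W by rewrite /W linearZ/= trmx_mul trmxK.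
have wwE : w *m w^T = (dot w w)%:M.
  by rewrite [LHS]mx11_scalar -dot_mulmx.
have WW : W *m W = 2%:R *: W.
  rewrite /W -scalemxAl -scalemxAr !scalerA mulmxA -(mulmxA w^T) wwE.
  rewrite mul_mx_scalar -scalemxAl scalerA; congr (_ *: _).
  by rewrite /c; field.
exists (1%:M - W).
  rewrite linearB/= trmx1 WT mulmxBl mul1mx mulmxBr mulmx1 WW scaler_nat mulr2n.
  by rewrite opprB addrK subrK.
rewrite mulmxBr mulmx1 /W -scalemxAr mulmxA.
have -> : x *m w^T = (dot x w)%:M by rewrite [LHS]mx11_scalar -dot_mulmx.
rewrite mul_scalar_mx scalerA.
have -> : c * dot x w = 1.
  have d1 : dot w w = 2 * dot x w.
    by rewrite /w dotBl !dotBr xx yy (dotC y x); ring.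
  by rewrite /c d1; field; move: ww; rewrite d1 mulf_eq0 negb_or => /andP[].
by rewrite scale1r opprB addrC subrK.
Qed.

End rotation.

Section caps.
Context {R : realType} {n : nat} (U : distr R n).
Hypothesis unifU : uniform_on_sphere U.
Implicit Types (x y u : 'rV[R]_n).

Definition cap y (eta : R) : set (borel_rV R n) :=
  [set x : 'rV[R]_n | sphere R n x /\ enorm (x - y) <= eta].

Lemma measurable_sphere : measurable (sphere R n : set (borel_rV R n)).
Proof.
have := @meas_norm2 R n measurableT [set 1] (measurable_set1 1).
rewrite setTI; congr measurable; apply/seteqP; split => x /=.
  by move=> h; apply/sphere_dot.
by move=> /sphere_dot.
Qed.

Lemma meas_dist y : meas (fun x => dot (x - y) (x - y)).
Proof.
suff h i : meas (fun x => (x - y) ord0 i) by exact: meas_dot.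
under eq_fun do rewrite addrC.
apply: continuous_meas => x.
apply: (@continuous_comp _ _ _ (fun x => - y + x) (fun x => x ord0 i)).
  exact: continuous_addl.
exact: coord_continuous.
Qed.

Lemma measurable_cap y eta : measurable (cap y eta).
Proof.
rewrite /cap (_ : [set _ | _] = sphere R n `&` [set x : 'rV[R]_n | enorm (x - y) <= eta]) //.
apply: measurableI; first exact: measurable_sphere.
case: (ltP eta 0) => [e0|e0].
  rewrite (_ : [set _ | _] = set0)//; apply/seteqP; split => x //=.
  by move=> h; have := lt_le_trans (le_lt_trans h e0) (enorm_ge0 (x - y)); rewrite ltxx.
have := meas_dist y measurableT `]-oo, eta ^+ 2]%classic (measurable_itv _).
rewrite setTI; congr measurable; apply/seteqP; split => x /=; rewrite in_itv/=.
  by rewrite -sqr_enorm ler_pXn2r// ?nnegrE ?enorm_ge0.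
by move=> h; rewrite -sqr_enorm ler_pXn2r// ?nnegrE ?enorm_ge0.
Qed.

Lemma cap_rotate y z eta : sphere R n y -> sphere R n z -> U (cap y eta) = U (cap z eta).
Proof.
move=> yS zS; have [Q QQ zQ] := orthogonal_transitive z y zS yS.
rewrite -(unifU.2 Q QQ _ (measurable_cap y eta)); congr (U _).
apply/seteqP; split => x /=; rewrite /cap /= -zQ.
  move=> [/sphere_dot h]; rewrite -mulmxBl /enorm dot_orthogonal// => h2.
  by split => //; apply/sphere_dot; rewrite dot_orthogonal in h.
move=> [/sphere_dot h h2]; split; first by apply/sphere_dot; rewrite dot_orthogonal.
by rewrite -mulmxBl /enorm dot_orthogonal.
Qed.

(** Rotations make all caps of one radius equally heavy, so a net of [N] centres forces each cap to
    carry mass at least [1 / N]; no surface integral is computed. *)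
Lemma cover_by_caps (I : Type) (s : seq I) (c : I -> 'rV[R]_n) eta z :
  sphere R n z -> (forall i, List.In i s -> sphere R n (c i)) ->
  (forall x, sphere R n x -> exists2 i, List.In i s & enorm (x - c i) <= eta) ->
  (1 <= (size s)%:R%:E * U (cap z eta))%E.
Proof.
move=> zS cS cov.
suff H : (U (\big[setU/set0]_(i <- s) cap (c i) eta) <= (size s)%:R%:E * U (cap z eta))%E.
  apply: le_trans H; rewrite -unifU.1; apply: le_measure; rewrite ?inE.
  - exact: measurable_sphere.
  - by apply: bigsetU_measurable => i _; exact: measurable_cap.
  move=> x xS; have [i + h] := cov _ xS.
  elim: (s) => [//|j s' IH] /=; rewrite big_cons => -[->|/IH ?]; last by right.
  by left; split.
elim: s cS {cov} => [|i s IH] cS; first by rewrite big_nil measure0 mul0e.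
have {}IH : (U (\big[setU/set0]_(i <- s) cap (c i) eta) <= (size s)%:R%:E * U (cap z eta))%E.
  by apply: IH => j js; apply: cS; right.
have st : (U (cap (c i) eta) + U (\big[setU/set0]_(i <- s) cap (c i) eta) <=
    (size (i :: s))%:R%:E * U (cap z eta))%E.
  rewrite (cap_rotate (c i) z eta)//; last by apply: cS; left.
  rewrite /= -natr1 addrC EFinD ge0_muleDl ?lee_fin// mul1e.
  by apply: leeD.
rewrite big_cons; apply: le_trans st; apply: measureU2.
  exact: measurable_cap.
by apply: bigsetU_measurable => ? _; exact: measurable_cap.
Qed.

Lemma expR1_le4 : expR 1 <= 4 :> R.
Proof.
have h : 1 / 2 <= expR (- (1 / 2) : R) by have := @expR_ge1Dx R (- (1 / 2)); lra.
have -> : expR 1 = expR (1 / 2) ^+ 2 :> R by rewrite expr2 -expRD; congr expR; field.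
rewrite (_ : 4 = 2 ^+ 2); last by ring.
rewrite ler_pXn2r ?nnegrE ?expR_ge0//.
by move: h; rewrite expRN ler_pdivrMr// ler_pdivlMl ?expR_gt0// mulr1 mulrC.
Qed.

Lemma sum_abs_sphere x : sphere R n x -> \sum_(i < n) `|x ord0 i| <= Num.sqrt n%:R.
Proof.
move=> /sphere_dot xx.
have n0 : (0 < n)%N.
  by case: n x xx => // x; rewrite /dot big_ord0 => /esym/eqP; rewrite oner_eq0.
set r := Num.sqrt (n%:R : R); have r0 : 0 < r by rewrite sqrtr_gt0 ltr0n.
have rr : r * r = n%:R by rewrite -expr2 sqr_sqrtr.
(* Termwise [2 a <= r a ^ 2 + 1 / r]; the choice [r = sqrt n] balances the two sums. *)
apply: (@le_trans _ _ (\sum_(i < n) (r * (x ord0 i * x ord0 i) + r^-1) / 2)).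
  apply: ler_sum => i _; set a := x ord0 i.
  have -> : a * a = `|a| * `|a| by rewrite -normrM ger0_norm// -expr2 sqr_ge0.
  have -> : (r * (`|a| * `|a|) + r^-1) / 2 = `|a| + (r * `|a| - 1) ^+ 2 / (2 * r).
    by field; rewrite gt_eqF.
  by rewrite lerDl divr_ge0 ?sqr_ge0// mulr_ge0// ltW.
rewrite -mulr_suml big_split/= -mulr_sumr [X in r * X]xx mulr1 sumr_const card_ord.
rewrite -[r^-1 *+ n]mulr_natr -rr; have -> : r^-1 * (r * r) = r by field; rewrite gt_eqF.
lra.
Qed.

(* A net of the sphere: one point for every nonempty cell of the grid of mesh
   [eta / sqrt n].  A cell with indices [m i] meets the sphere only if
   [\sum_i m i <= n / eta], so that [(1 + eta) ^ (n / eta) * \prod_i (1 + eta) ^- m i]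
   bounds the number of these cells without a factor [n ^ n]. *)
Lemma cap_lower_bound z eta : sphere R n z -> 0 < eta -> eta <= 1 ->
  (((eta / 16) ^+ n)%:E <= U (cap z eta))%E.
Proof.
move=> zS eta0 eta1.
have n0 : (0 < n)%N.
  by case: n z zS => // x /sphere_dot; rewrite /dot big_ord0 => /esym/eqP; rewrite oner_eq0.
set r := Num.sqrt (n%:R : R); have r0 : 0 < r by rewrite sqrtr_gt0 ltr0n.
have rr : r * r = n%:R by rewrite -expr2 sqr_sqrtr.
set h := eta / r; have h0 : 0 < h by rewrite divr_gt0.
pose idx (x : 'rV[R]_n) (i : 'I_n) : nat := Num.truncn (`|x ord0 i| / h).
pose K := (Num.truncn h^-1).+1.
have idxK x i : sphere R n x -> (idx x i < K)%N.
  move=> xS; rewrite ltnS /idx; apply: le_truncn.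
  rewrite -[leRHS]mul1r ler_pM2r ?invr_gt0// -xS; exact: enorm_coord.
(* A cell fixes the sign of each coordinate and the integer part of its absolute value in units of
   [h]. *)
pose C := {ffun 'I_n -> bool * 'I_K}.
pose cell (t : C) : set 'rV[R]_n := [set x | sphere R n x /\
  forall i, (0 <= x ord0 i) = (t i).1 /\ idx x i = (t i).2].
have [c cP] : {c : C -> 'rV[R]_n & forall t, cell t !=set0 -> cell t (c t)}.
  exists (fun t => if pselect (cell t !=set0) is left e then projT1 (cid e) else 0) => t e.
  by case: pselect => // e'; case: cid.
pose s := [seq t <- enum C | `[< cell t !=set0 >]].
have inS t : List.In t s <-> cell t !=set0.
  have -> : List.In t s <-> t \in s.
    elim: (s) => [//|a l IH] /=; rewrite in_cons IH; split.
      by move=> [->|->]; rewrite ?eqxx// orbT.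
    by move=> /orP[/eqP ->|]; [left|right].
  by rewrite mem_filter mem_enum andbT; split => /asboolP.
have main := cover_by_caps C s c eta z zS.
have {}main : (1 <= (size s)%:R%:E * U (cap z eta))%E.
  apply: main => [t /inS /cP[]//|x xS].
  pose t : C := [ffun i => (0 <= x ord0 i, inord (idx x i))].
  have xt : cell t x.
    by split => // i; rewrite ffunE/= inordK//; exact: idxK.
  have ts : cell t !=set0 by exists x.
  exists t; first exact/inS.
  (* Two points of one cell differ by at most [h] in each coordinate, and [n h ^ 2 = eta ^ 2]. *)
  have [yS yt] := cP _ ts; set y := c t in yS yt *.
  rewrite -(@ler_pXn2r _ 2) ?nnegrE ?enorm_ge0//; last exact: ltW.
  rewrite sqr_enorm.
  have -> : eta ^+ 2 = \sum_(i < n) h ^+ 2.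
    rewrite sumr_const card_ord -[_ *+ n]mulr_natr -rr /h; field; by rewrite gt_eqF.
  apply: ler_sum => i _; rewrite -expr2 -real_normK ?num_real//.
  rewrite ler_pXn2r ?nnegrE ?normr_ge0//; last exact: ltW.
  rewrite !mxE; have [sx ix] := xt.2 i; have [sy iy] := yt i.
  rewrite -sx in sy; rewrite -ix in iy.
  have /andP[x1 x2] : (idx x i)%:R <= `|x ord0 i| / h < (idx x i).+1%:R.
    by apply: truncn_itv; rewrite divr_ge0// ltW.
  have /andP[y1 y2] : (idx x i)%:R <= `|y ord0 i| / h < (idx x i).+1%:R.
    by rewrite -iy; apply: truncn_itv; rewrite divr_ge0// ltW.
  have -> : `|x ord0 i - y ord0 i| = `| `|x ord0 i| - `|y ord0 i| |.
    move: sy; case: (leP 0 (x ord0 i)) => hx; case: (leP 0 (y ord0 i)) => hy // _.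
      by rewrite (ger0_norm hx) (ger0_norm hy).
    by rewrite [LHS]distrC (ltr0_norm hx) (ltr0_norm hy) opprK addrC.
  rewrite -[leRHS]mul1r -ler_pdivrMr// -{1}(gtr0_norm h0) -normf_div mulrBl.
  move: x1 x2 y1 y2; rewrite -natr1.
  set p := `|x ord0 i| / h; set q := `|y ord0 i| / h => x1 x2 y1 y2.
  by rewrite ler_norml; apply/andP; split; lra.
have size_le : (size s)%:R <= (16 / eta) ^+ n.
  have e1 : 0 < 1 + eta by lra.
  pose w (t : C) : R := \prod_(i < n) (1 + eta) ^- (t i).2.
  have w0 t : 0 <= w t by apply: prodr_ge0 => i _; rewrite invr_ge0 exprn_ge0// ltW.
  have cell_w t : cell t !=set0 -> 1 <= 4 ^+ n * w t.
    move=> [x [xS xt]].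
    have sm : (\sum_(i < n) (t i).2 : nat)%:R * eta <= n%:R.
      rewrite -ler_pdivlMr// natr_sum.
      apply: (@le_trans _ _ (\sum_(i < n) (`|x ord0 i| / h))).
        apply: ler_sum => i _; rewrite -(xt i).2.
        by rewrite truncn_le divr_ge0// ltW.
      rewrite -mulr_suml ler_pdivrMr// /h -rr.
      have -> : r * r / eta * (eta / r) = r by field; rewrite !gt_eqF.
      exact: sum_abs_sphere.
    rewrite /w prodfV -expr_sum -ler_pdivrMr ?invr_gt0 ?exprn_gt0// invrK mul1r.
    set m := (\sum_(i < n) _)%N in sm *.
    apply: (@le_trans _ _ (expR (m%:R * eta))).
      by rewrite expRM_natl lerXn2r ?nnegrE ?expR_ge0 ?expR_ge1Dx// ltW.
    apply: (@le_trans _ _ (expR (n%:R * 1))); first by rewrite ler_expR mulr1.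
    by rewrite expRM_natl ler_pXn2r ?nnegrE ?expR_ge0// expR1_le4.
  have -> : (size s)%:R = \sum_(t <- s) (1 : R).
    by rewrite big_const_seq count_predT iter_addr_0.
  apply: (@le_trans _ _ (\sum_(t <- s) 4 ^+ n * w t)).
    rewrite big_seq [leRHS]big_seq; apply: ler_sum => t.
    by rewrite mem_filter => /andP[/asboolP ? _]; exact: cell_w.
  apply: (@le_trans _ _ (\sum_t 4 ^+ n * w t)).
    rewrite big_filter big_enum_cond/= [leRHS](bigID (fun t => `[< cell t !=set0 >]))/=.
    by rewrite lerDl sumr_ge0// => t _; rewrite mulr_ge0 ?exprn_ge0.
  (* The sum over all cells factors over the coordinates. Each factor is twice (for the sign) a
     geometric series bounded by [2 / eta]; with the 4 this makes [16 / eta]. *)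
  rewrite -mulr_sumr /w.
  rewrite -(bigA_distr_bigA (fun (i : 'I_n) (p : bool * 'I_K) => (1 + eta) ^- p.2)).
  rewrite prodr_const card_ord -exprMn ler_pXn2r ?nnegrE//; first last.
  - by rewrite divr_ge0// ltW.
  - by rewrite mulr_ge0// sumr_ge0// => p _; rewrite invr_ge0 exprn_ge0// ltW.
  rewrite -(pair_big predT predT (fun (_ : bool) (j : 'I_K) => (1 + eta) ^- j))/=.
  rewrite big_bool/=.
  have geo : \sum_(j < K) (1 + eta) ^- j <= 2 / eta.
    have q1 : 1 - (1 + eta)^-1 = eta / (1 + eta) by field; rewrite gt_eqF.
    have q0 : 0 < 1 - (1 + eta)^-1 by rewrite q1 divr_gt0.
    have := subrX1 ((1 + eta)^-1) K.
    under [X in _ = _ * X]eq_bigr do rewrite exprVn.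
    set S := \sum_(j < K) _ => e.
    have : S * (1 - (1 + eta)^-1) <= 1.
      have : 0 <= (1 + eta)^-1 ^+ K by rewrite exprn_ge0// invr_ge0 ltW.
      move: e; set qK := _ ^+ K => e; lra.
    rewrite -ler_pdivlMr// q1 mul1r invf_div => /le_trans; apply.
    by rewrite ler_pM2r ?invr_gt0//; lra.
  have -> : 16 / eta = 4 * (2 / eta + 2 / eta) by field; rewrite gt_eqF.
  by rewrite ler_pM2l//; lra.
have s0 : (0 : R) < (size s)%:R.
  rewrite ltr0n lt0n; apply: contraTneq main => ->.
  by rewrite mul0e -ltNge lte_fin.
apply: (@le_trans _ _ ((size s)%:R^-1)%:E).
  rewrite lee_fin -[leLHS]invrK lef_pV2 ?posrE ?invr_gt0 ?exprn_gt0 ?divr_gt0//.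
  by rewrite -exprVn invf_div.
by rewrite -[leLHS]mule1 lee_pdivrMl.
Qed.

End caps.

(** * The linearised loss *)

Lemma is_diff_dot {R : realType} {n k : nat} (G : 'rV[R]_n -> 'rV[R]_k) (w : 'rV[R]_k) x :
  differentiable G x ->
  is_diff x (fun x => dot w (G x)) (fun u => dot w ('d G x u)).
Proof.
move=> dG.
have lin : linear (dot w : 'rV[R]_k -> R) by move=> a u v; rewrite dotDr dotZr.
pose lM := GRing.isLinear.Build _ _ _ _ _ lin.
pose l : {linear 'rV[R]_k -> R} := HB.pack (dot w : 'rV[R]_k -> R) lM.
have cl : continuous l.
  rewrite (_ : (l : _ -> _) = fun y : 'rV[R]_k => \sum_(i < k) w ord0 i * y ord0 i)//.
  apply: continuous_big => [|i _ y]; first exact: add_continuous.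
  apply: (@continuous_comp _ _ _ (fun y : 'rV[R]_k => y ord0 i) (fun t => w ord0 i * t)).
    exact: coord_continuous.
  exact: mulrl_continuous.
have dl : differentiable l (G x) by exact: linear_differentiable.
apply: DiffDef.
  exact: (@differentiable_comp _ _ _ _ G l x dG dl).
by rewrite -[fun x => _]/(l \o G) diff_comp// diff_lin.
Qed.

(** Otherwise the slope at [y] towards [z] exceeds that of the chord, and [f] lies strictly above
    the chord just after [y]. *)
Lemma convex_grad_le {R : realType} {k : nat} (f : 'rV[R]_k -> R) y z :
  convex_function setT (f : 'rV[R]_k -> R^o) -> differentiable f y ->
  f y + dot (grad f y) (z - y) <= f z.
Proof.
move=> cf df; rewrite leNgt; apply/negP => lt.
have lt' : f z - f y < 'd f y (z - y) by rewrite diff_grad// ltrBlDl.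
have df0 : differentiable f (y + 0 *: (z - y)) by rewrite scale0r addr0.
have D1 := is_derive_line f y (z - y) 0 df0.
rewrite scale0r addr0 in D1.
have D2 := is_derive_quadratic 0 (f z - f y) 0 0.
have := is_derive_right_gt _ _ _ (@is_deriveB _ _ _ _ _ _ _ _ _ D1 D2).
rewrite !mulr0 !addr0 subr_gt0 => /(_ lt')[e e0].
set s : R := Num.min (e / 2) (1 / 2).
have s0 : 0 < s by rewrite lt_min; apply/andP; split; lra.
have se : s < e by rewrite gt_min; apply/orP; left; lra.
have s8 : s <= 1 / 2 by rewrite ge_min lexx orbT.
move=> /(_ s); rewrite add0r s0 se => /(_ isT).
rewrite -![(_ - _ : _ -> _) _]/(_ - _)/= scale0r addr0 !mul0r !mulr0 !addr0 subr0 add0r.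
have s1 : s <= 1 by lra.
have h1 : f (s *: z + (1 - s) *: y) <= s * f z + (1 - s) * f y.
  have := cf (Itv01 (ltW s0) s1) z y; rewrite !inE; exact.
have -> : y + s *: (z - y) = s *: z + (1 - s) *: y.
  by rewrite scalerBr scalerBl scale1r addrCA.
move: h1; lra.
Qed.

(* All the constants of the problem, and the inverse of the lower bound on V,
   replaced by a single bound [S]. *)
Record landscape {R : realType} {n k : nat} (Rf : 'rV[R]_k -> R)
  (Phi : 'rV[R]_n -> 'rV[R]_k) (V : 'rV[R]_n -> R) (S : R) : Prop := Landscape {
  ls_S : 1 <= S;
  ls_convex : forall y z, Rf y + dot (grad Rf y) (z - y) <= Rf z;
  ls_ge0 : forall y, 0 <= Rf y;
  ls_diff : forall y, differentiable Rf y;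
  ls_grad : forall y, enorm (grad Rf y) <= S;
  ls_lip : forall y z, enorm (grad Rf y - grad Rf z) <= S * enorm (y - z);
  ls_Phi_hom : homogeneous2 Phi;
  ls_Phi_diff : forall x, differentiable Phi x;
  ls_Phi_bound : forall a x, `|dot a (Phi x)| <= S * enorm a * dot x x;
  ls_Phi_lip : forall a x y, sphere R n x -> sphere R n y ->
    `|dot a (Phi x) - dot a (Phi y)| <= S ^+ 2 * enorm a * enorm (x - y);
  ls_V_hom : homogeneous2 (V : 'rV[R]_n -> R^o);
  ls_V_diff : forall x, differentiable V x;
  ls_V_lower : forall x, dot x x <= S * V x;
  ls_V_upper : forall x, V x <= S * dot x x;
  ls_V_grad : forall x, enorm (grad V x) <= S * enorm x;
  ls_V_lip : forall x y, sphere R n x -> sphere R n y ->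
    `|V x - V y| <= S * enorm (x - y)
}.

Lemma homogeneous_dot {R : realType} {n k : nat} (Phi : 'rV[R]_n -> 'rV[R]_k) a :
  homogeneous2 Phi -> homogeneous2 ((fun x => dot a (Phi x)) : 'rV[R]_n -> R^o).
Proof. by move=> h c x; rewrite h dotZr. Qed.

(** [k <= S] pays for the sum that turns the coordinatewise Lipschitz bound on [Phi] into
    [ls_Phi_lip]; [b_V^-1 <= S] gives the coercivity [ls_V_lower]. *)
Lemma regularity_landscape {R : realType} {n k : nat} (Rf : 'rV[R]_k -> R)
  (Phi : 'rV[R]_n -> 'rV[R]_k) (V : 'rV[R]_n -> R)
  (M_R C_R B_Phi M_Phi b_V B_V M_V S : R) :
  homogeneous2 Phi -> homogeneous2 (V : 'rV[R]_n -> R^o) ->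
  regularity Rf Phi V M_R C_R B_Phi M_Phi b_V B_V M_V ->
  1 <= S -> k%:R <= S -> M_R <= S -> C_R <= S -> B_Phi <= S -> M_Phi <= S ->
  b_V^-1 <= S -> B_V <= S -> M_V <= S -> landscape Rf Phi V S.
Proof.
move=> hPhi hV reg S1 kS MRS CRS BPS MPS bVS BVS MVS.
have S0 : 0 <= S by exact: le_trans S1.
have b0 := reg_b_V_gt0 reg.
have dPhi := reg_Phi_diff reg; have dV := reg_V_diff reg.
have Vb x : sphere R n x -> `|V x| <= S.
  move=> /(reg_V_bound reg)/andP[v1 v2].
  by rewrite ger0_norm ?(le_trans v2)// (le_trans _ v1)// ltW.
have Vg x : sphere R n x -> enorm (grad V x) <= S.
  by move=> /(reg_V_grad reg)/le_trans; apply.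
split => //.
- by move=> y z; apply: convex_grad_le; [exact: reg_R_convex reg|exact: (reg_R_diff reg y)].
- exact: reg_R_ge0 reg.
- exact: reg_R_diff reg.
- by move=> y; rewrite (le_trans (reg_R_grad reg y)).
(* The Hessian bound becomes a Lipschitz bound on the gradient by testing against a unit vector and
   moving along the segment. *)
- move=> y z; apply: enorm_le_dual => [u u1|]; last by rewrite mulr_ge0 ?enorm_ge0.
  have dd x : is_diff x (fun x => dot u (grad Rf x)) (fun v => dot u ('d (grad Rf) x v)).
    by apply: is_diff_dot; exact: reg_R_diff2 reg x.
  rewrite dotBr.
  apply: (le_segment (fun x => dot u (grad Rf x))) => [x|s _].
    by have := dd x => /@ex_diff.
  set p := z + _; have /@diff_val -> := dd p.
  rewrite (le_trans (ler_norm _))// (le_trans (cauchy_schwarz _ _))// u1 mul1r.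
  by rewrite (le_trans (reg_R_hess reg _ _))// ler_wpM2r ?enorm_ge0.
- move=> a x; apply: (hom_le_sphere _ (homogeneous_dot Phi a hPhi)) => y yS.
  rewrite (le_trans (cauchy_schwarz _ _))// mulrC ler_wpM2r ?enorm_ge0//.
  by rewrite (le_trans (reg_Phi_bound reg yS)).
- move=> a x y xS yS; rewrite -dotBr /dot (le_trans (ler_norm_sum _ _ _))//.
  apply: (@le_trans _ _ (\sum_(i < k) enorm a * (S * enorm (x - y)))).
    apply: ler_sum => i _; rewrite normrM ler_pM ?enorm_coord// !mxE.
    by rewrite (le_trans (reg_Phi_lip reg xS yS i))// ler_wpM2r ?enorm_ge0.
  rewrite sumr_const card_ord -[_ *+ k]mulr_natr.
  have -> : enorm a * (S * enorm (x - y)) * k%:R = k%:R * (S * enorm a * enorm (x - y)).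
    by ring.
  have -> : S ^+ 2 * enorm a * enorm (x - y) = S * (S * enorm a * enorm (x - y)).
    by ring.
  by rewrite ler_wpM2r// !mulr_ge0 ?enorm_ge0.
- move=> x; have [->|x0] := eqVneq x 0; first by rewrite (hom0 _ hV) dot0l mulr0.
  have e0 : 0 < enorm x by rewrite lt_def enorm_ge0 enorm_eq0 x0.
  have -> : x = enorm x *: ((enorm x)^-1 *: x).
    by rewrite scalerA divff ?scale1r// gt_eqF.
  have yS := sphere_normalize x x0.
  rewrite (homE _ hV) dotZl dotZr (sphere_dot _).1// mulr1 -expr2.
  rewrite mulrCA ler_peMr ?sqr_ge0//.
  have /andP[v1 _] := reg_V_bound reg yS.
  have := ler_pM (ltW b0) _ v1 bVS; rewrite divff ?gt_eqF//.
  by rewrite mulrC; apply; rewrite invr_ge0 ltW.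
- by move=> x; rewrite (le_trans (ler_norm _))//; exact: (hom_le_sphere V hV).
- by move=> x; exact: (grad_le_sphere V hV dV).
- move=> x y xS yS; rewrite ler_norml; apply/andP; split.
    rewrite lerNl opprB -enormN opprB; exact: (lipschitz_le_grad V hV dV).
  exact: (lipschitz_le_grad V hV dV).
Qed.

Lemma is_derive_comp_rV {R : realType} {k : nat} (m : R -> 'rV[R]_k)
  (G : 'rV[R]_k -> R) (t : R) :
  derivable m t 1 -> differentiable G (m t) ->
  is_derive t 1 (G \o m) ('d G (m t) ('D_1 m t)).
Proof.
move=> /derivable1_diffP dm dG.
have dc : differentiable (G \o m) t by exact: differentiable_comp.
apply: DeriveDef; first exact/derivable1_diffP.
by rewrite deriveE// diff_comp// deriveE.
Qed.

Section potential.
Context {R : realType} {n k : nat} {Rf : 'rV[R]_k -> R}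
  {Phi : 'rV[R]_n -> 'rV[R]_k} {V : 'rV[R]_n -> R} {S : R}.
Hypothesis ls : landscape Rf Phi V S.
Implicit Types (a : 'rV[R]_k) (x y : 'rV[R]_n).

(** This is [dloss] as a function of the force [a = grad Rf (meanPhi Phi rho)]: the distribution,
    hence time, enters only through a vector of dimension [k]. *)
Definition potential a x := dot a (Phi x) + V x.

Let S0 : 0 < S. Proof. by apply: lt_le_trans (ls_S _ _ _ _ ls). Qed.

Lemma diff_dotPhi a x : differentiable (fun x => dot a (Phi x)) x.
Proof. by have := is_diff_dot Phi a x (ls_Phi_diff _ _ _ _ ls x) => /@ex_diff. Qed.

Lemma hom_dotPhi a : homogeneous2 ((fun x => dot a (Phi x)) : 'rV[R]_n -> R^o).
Proof. by apply: homogeneous_dot; exact: ls_Phi_hom ls. Qed.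

(** The regularity conditions control only the size and the variation of [Phi] on the sphere;
    homogeneity supplies the radial part of the gradient. The factor 4 comes from [2 (S + S ^ 2)]
    and [1 <= S]. *)
Lemma grad_dotPhi_le a x :
  enorm (grad (fun x => dot a (Phi x)) x) <= 4 * S ^+ 2 * enorm a * enorm x.
Proof.
have S1 := ls_S _ _ _ _ ls.
apply: (@le_trans _ _ (2 * (S * enorm a + S ^+ 2 * enorm a) * enorm x)).
  apply: (grad_le_lipschitz _ (hom_dotPhi a) (diff_dotPhi a)).
  - move=> y /sphere_dot yy; have := ls_Phi_bound _ _ _ _ ls a y.
    by rewrite yy mulr1.
  - by rewrite mulr_ge0 ?enorm_ge0// exprn_ge0// ltW.
  - by move=> y z; exact: ls_Phi_lip ls a y z.
rewrite ler_wpM2r ?enorm_ge0//.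
have -> : 4 * S ^+ 2 * enorm a = 2 * (S * S * enorm a + S ^+ 2 * enorm a) by ring.
rewrite ler_pM2l// lerD2r ler_wpM2r ?enorm_ge0//.
by rewrite -{1}[S]mul1r ler_pM2r.
Qed.

Lemma hom_potential a : homogeneous2 (potential a : 'rV[R]_n -> R^o).
Proof.
move=> c x; rewrite /potential (ls_Phi_hom _ _ _ _ ls) dotZr.
rewrite (homE _ (ls_V_hom _ _ _ _ ls)) -[RHS]/(c ^+ 2 * _) mulrDr//.
Qed.

Lemma potential_is_diff a x : is_diff x (potential a)
  (fun u => 'd (fun x => dot a (Phi x)) x u + 'd V x u).
Proof.
have dV := ls_V_diff _ _ _ _ ls x.
rewrite -[potential a]/((fun x => dot a (Phi x)) + V).
apply: DiffDef; first by apply: differentiableD => //; exact: diff_dotPhi.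
by rewrite diffD//; exact: diff_dotPhi.
Qed.

Lemma diff_potential a x : differentiable (potential a) x.
Proof. by have := potential_is_diff a x => /@ex_diff. Qed.

Lemma grad_potential a x :
  grad (potential a) x = grad (fun x => dot a (Phi x)) x + grad V x.
Proof.
apply: grad_unique; first exact: diff_potential.
move=> u; have := potential_is_diff a x => /@diff_val ->.
rewrite dotDl -!diff_grad//; [exact: ls_V_diff ls x|exact: diff_dotPhi].
Qed.

Lemma potential_le a x : enorm a <= S -> `|potential a x| <= 2 * S ^+ 2 * dot x x.
Proof.
move=> aS; have S1 := ls_S _ _ _ _ ls; have x0 := dot_ge0 x.
have h1 := ls_Phi_bound _ _ _ _ ls a x.
have h2 : 0 <= V x.
  by have := ls_V_lower _ _ _ _ ls x => /(le_trans x0); rewrite pmulr_rge0.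
have h3 := ls_V_upper _ _ _ _ ls x.
rewrite /potential (le_trans (ler_normD _ _))// (ger0_norm h2).
have -> : 2 * S ^+ 2 * dot x x = S * S * dot x x + S * S * dot x x by ring.
apply: lerD.
  by rewrite (le_trans h1)// ler_wpM2r// ler_pM2l.
by rewrite (le_trans h3)// ler_wpM2r// -{1}[S]mul1r ler_pM2r.
Qed.

Lemma grad_potential_le a x : enorm a <= S ->
  enorm (grad (potential a) x) <= 5 * S ^+ 3 * enorm x.
Proof.
move=> aS; have S1 := ls_S _ _ _ _ ls.
rewrite grad_potential (le_trans (enormD _ _))//.
have -> : 5 * S ^+ 3 * enorm x = 4 * S ^+ 2 * S * enorm x + S * S * S * enorm x by ring.
apply: lerD.
  rewrite (le_trans (grad_dotPhi_le _ _))// ler_wpM2r ?enorm_ge0//.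
  by rewrite ler_pM2l// mulr_gt0// exprn_gt0.
rewrite (le_trans (ls_V_grad _ _ _ _ ls x))// ler_wpM2r ?enorm_ge0//.
by rewrite -{1}[S]mul1r ler_pM2r// mulr_ege1.
Qed.

Lemma potential_lip a x y : enorm a <= S -> sphere R n x -> sphere R n y ->
  `|potential a x - potential a y| <= 2 * S ^+ 3 * enorm (x - y).
Proof.
move=> aS xS yS; have S1 := ls_S _ _ _ _ ls.
have -> : potential a x - potential a y =
  (dot a (Phi x) - dot a (Phi y)) + (V x - V y) by rewrite /potential; ring.
have -> : 2 * S ^+ 3 * enorm (x - y) =
  S ^+ 2 * S * enorm (x - y) + S * S * S * enorm (x - y) by ring.
rewrite (le_trans (ler_normD _ _))// lerD//.
  rewrite (le_trans (ls_Phi_lip _ _ _ _ ls a x y xS yS))// ler_wpM2r ?enorm_ge0//.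
  by rewrite ler_pM2l// exprn_gt0.
rewrite (le_trans (ls_V_lip _ _ _ _ ls x y xS yS))// ler_wpM2r ?enorm_ge0//.
by rewrite -{1}[S]mul1r ler_pM2r// mulr_ege1.
Qed.

Lemma test_of_grad_le (f : 'rV[R]_n -> R) c : (forall x, differentiable f x) ->
  (forall x, enorm (grad f x) <= c * enorm x) -> test_function f.
Proof.
move=> df gf; split=> //; exists `|c| => x.
apply: (le_trans (gf x)); apply: (@le_trans _ _ (`|c| * enorm x)).
  by rewrite ler_wpM2r ?enorm_ge0// ler_norm.
by rewrite mulrDr mulr1 lerDr.
Qed.

Lemma test_dotPhi a : test_function (fun x => dot a (Phi x)).
Proof. exact: test_of_grad_le (diff_dotPhi a) (grad_dotPhi_le a). Qed.

Lemma test_V : test_function V.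
Proof. exact: test_of_grad_le (ls_V_diff _ _ _ _ ls) (ls_V_grad _ _ _ _ ls). Qed.

Lemma quadratic_dotPhi a : quadratic (fun x => dot a (Phi x)).
Proof.
apply: quadratic_bound (ls_Phi_bound _ _ _ _ ls a).
by apply: differentiable_meas => x; exact: diff_dotPhi.
Qed.

Lemma V_ge0 x : 0 <= V x.
Proof.
by have := ls_V_lower _ _ _ _ ls x => /(le_trans (dot_ge0 x)); rewrite pmulr_rge0.
Qed.

Lemma quadratic_V : quadratic V.
Proof.
apply: (quadratic_bound _ S); first exact: (differentiable_meas _ (ls_V_diff _ _ _ _ ls)).
by move=> x; rewrite ger0_norm ?V_ge0//; exact: (ls_V_upper _ _ _ _ ls x).
Qed.

Lemma quadratic_potential a : quadratic (potential a).
Proof. by apply: quadraticD; [exact: quadratic_dotPhi|exact: quadratic_V]. Qed.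

Lemma quadratic_grad2 (f g : 'rV[R]_n -> R) c c' :
  (forall x, differentiable f x) -> (forall x, differentiable g x) ->
  (forall x, enorm (grad f x) <= c * enorm x) ->
  (forall x, enorm (grad g x) <= c' * enorm x) ->
  quadratic (fun x => dot (grad f x) (grad g x)).
Proof.
move=> df dg fc gc; apply: (quadratic_bound _ (c * c')).
  by apply: meas_dot => i; exact: meas_grad.
move=> x; rewrite (le_trans (cauchy_schwarz _ _))//.
have -> : c * c' * dot x x = (c * enorm x) * (c' * enorm x).
  by rewrite -sqr_enorm; ring.
by rewrite ler_pM ?enorm_ge0.
Qed.

Lemma dotPhi_coord i x : dot (delta_mx ord0 i) (Phi x) = Phi x ord0 i.
Proof. by rewrite dotC dot_delta. Qed.

Lemma mean_coord (rho : distr R n) i :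
  meanPhi Phi rho ord0 i = expect rho (fun x => dot (delta_mx ord0 i) (Phi x)).
Proof.
by rewrite mxE; congr expect; apply/funext => x; rewrite dotPhi_coord.
Qed.

Lemma dot_mean (rho : distr R n) a : moment2 rho ->
  dot a (meanPhi Phi rho) = expect rho (fun x => dot a (Phi x)).
Proof.
move=> m2; have q i : quadratic (fun x => a ord0 i * Phi x ord0 i).
  apply: quadraticZ; have := quadratic_dotPhi (delta_mx ord0 i).
  by under eq_fun do rewrite dotPhi_coord.
have [_ e] := expect_sum rho (fun i x => a ord0 i * Phi x ord0 i) m2 q.
rewrite /dot e; apply: eq_bigr => i _; rewrite mean_coord -expectZ//.
  by congr expect; apply/funext => x; rewrite dotPhi_coord.
exact: quadratic_dotPhi.
Qed.

Definition loss_val (rho : distr R n) := Rf (meanPhi Phi rho) + expect rho V.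

Lemma lossE (rho : distr R n) : moment2 rho -> loss Rf Phi V rho = (loss_val rho)%:E.
Proof. by move=> m2; rewrite /loss expectE//; exact: quadratic_V. Qed.

(** Coercivity: [S * V] dominates the squared norm and [Rf] is nonnegative, so a bounded loss will
    bound the second moment along the flow. *)
Lemma moment_le_loss (rho : distr R n) : moment2 rho ->
  expect rho (fun x => dot x x) <= S * loss_val rho.
Proof.
move=> m2; apply: (@le_trans _ _ (S * expect rho V)); last first.
  by rewrite ler_pM2l// lerDr; exact: ls_ge0 ls _.
rewrite -expectZ//; last exact: quadratic_V.
apply: expect_le => //; first exact: quadratic_norm2.
  by apply: quadraticZ; exact: quadratic_V.
exact: ls_V_lower ls.
Qed.

Lemma loss_val_ge0 (rho : distr R n) : 0 <= loss_val rho.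
Proof.
by apply: addr_ge0; [exact: ls_ge0 ls _|apply: expect_ge0; exact: V_ge0].
Qed.

(** The infimum of the loss ranges over all distributions; its near-minimisers have finite loss, and
    this makes them integrate quadratic functions. *)
Lemma moment2_of_loss (rho : distr R n) : (loss Rf Phi V rho < +oo)%E -> moment2 rho.
Proof.
have S1 := ls_S _ _ _ _ ls.
rewrite /loss; set I := (\int[_]_x _)%E => h.
have I0 : (0 <= I)%E by apply: integral_ge0 => x _; rewrite lee_fin V_ge0.
have {}h : (I < +oo)%E.
  by move: h I0; case: I => //= r; rewrite ?ltry.
rewrite /moment2; apply: (@le_lt_trans _ _ (\int[rho]_x (S%:E * (V x)%:E)%E)%E).
  apply: ge0_le_integral => //.
  - by move=> x _; rewrite lee_fin sqr_ge0.
  - apply/measurable_EFinP; under eq_fun do rewrite sqr_enorm.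
    exact: meas_norm2.
  - apply/measurable_EFinP; apply: measM; first exact: meas_cst.
    by have [] := quadratic_V.
  - by move=> x _; rewrite -EFinM lee_fin sqr_enorm; exact: (ls_V_lower _ _ _ _ ls x).
rewrite ge0_integralZl//; first by rewrite lte_mul_pinfty// lee_fin ltW.
- by apply/measurable_EFinP; have [] := quadratic_V.
- by move=> x _; rewrite lee_fin V_ge0.
- by rewrite lee_fin ltW.
Qed.

(** The tangent inequality of [Rf] at the mean of [rho]; the [V] part is linear in the
    distribution. *)
Lemma loss_convex (rho mu : distr R n) : moment2 rho -> moment2 mu ->
  loss_val rho - loss_val mu <=
    expect rho (potential (grad Rf (meanPhi Phi rho))) -
    expect mu (potential (grad Rf (meanPhi Phi rho))).
Proof.
move=> m2 m2'; set a := grad _ _; have := ls_convex _ _ _ _ ls (meanPhi Phi rho) (meanPhi Phi mu).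
rewrite -/a dotBr !dot_mean// /potential !expectD//; try exact: quadratic_dotPhi; try exact: quadratic_V.
rewrite /loss_val; lra.
Qed.

End potential.

(** * Energy and displacement along the flow *)

Lemma cvg_rV {R : realType} {k : nat} {T : Type} (F : set_system T) {FF : Filter F}
  (m : T -> 'rV[R]_k) (l : 'rV[R]_k) :
  (forall i, (fun t => m t ord0 i) @ F --> l ord0 i) -> m @ F --> l.
Proof.
move=> h; apply/cvgrPdist_le => e e0; near=> t.
rewrite /Num.Def.normr/= mx_normrE (bigmax_le _ (ltW e0))//= => -[i j] _.
rewrite !mxE/= (ord1 i); move: j; near: t; apply: filter_forall => j.
exact: ((cvgrPdist_le _ _).1 (h j)).
Unshelve. all: by end_near. Qed.

(** The flow equation holds at positive times only; at time 0 continuity rests on the right limit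
    from [flow_init]. *)
Lemma within_continuous_ge0 {R : realType} (F : R -> R) (a b : R) :
  (forall t, 0 < t -> derivable F t 1) -> F @ 0^'+ --> F 0 ->
  0 <= a -> {within `[a, b], continuous F}.
Proof.
move=> dF F0 a0.
have cF t : 0 < t -> {for t, continuous F}.
  by move=> /dF /derivable1_diffP; exact: differentiable_continuous.
have [ab|ba|<-] := ltgtP a b; last 2 first.
- rewrite set_itv_ge ?bnd_simp -?ltNge//; exact: continuous_subspace0.
- rewrite set_itv1; exact: continuous_subspace1.
apply/(continuous_within_itvP _ ab); split.
- by move=> t; rewrite in_itv/= => /andP[ta _]; apply: cF; exact: le_lt_trans ta.
- move: a0; rewrite le_eqVlt => /predU1P[<-//|a0].
  by apply: cvg_at_right_filter; exact: cF.
- by apply: cvg_at_left_filter; apply: cF; exact: le_lt_trans ab.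
Qed.

Section flow.
Context {R : realType} {n k : nat} {Rf : 'rV[R]_k -> R}
  {Phi : 'rV[R]_n -> 'rV[R]_k} {V : 'rV[R]_n -> R} {S : R}.
Hypothesis ls : landscape Rf Phi V S.
Context {U : distr R n}.
Hypothesis unifU : uniform_on_sphere U.
Context {sigma : R} {rho : R -> distr R n}.
Hypothesis sigma_gt0 : 0 < sigma.
Hypothesis flow : perturbed_flow Rf Phi V sigma U rho.
Implicit Types (x : 'rV[R]_n) (t s : R).

Let S1 : 1 <= S. Proof. exact: ls_S ls. Qed.
Let S0 : 0 < S. Proof. exact: lt_le_trans S1. Qed.

Let mean t := meanPhi Phi (rho t).
Let force t := grad Rf (mean t).
Let pot t := potential (Phi := Phi) (V := V) (force t).
Let L t := loss_val (Rf := Rf) (Phi := Phi) (V := V) (rho t).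
Definition dissipation t := expect (rho t) (fun x => dot (grad (pot t) x) (grad (pot t) x)).

Lemma integral_uniform_norm2 : (\int[U]_x ((enorm (x : 'rV[R]_n)) ^+ 2)%:E = 1)%E.
Proof.
transitivity (\int[U]_x (cst 1%E x))%E; last first.
  by rewrite integral_cst// mul1e; exact: (@probability_setT _ (borel_rV R n) R U).
apply: ge0_ae_eq_integral => //.
- by apply/measurable_EFinP; under eq_fun do rewrite sqr_enorm; exact: meas_norm2.
  by move=> x _; rewrite lee_fin sqr_ge0.
exists (~` (sphere R n)); split.
- by apply: measurableC; exact: (@measurable_sphere R n).
- rewrite [LHS](@probability_setC _ (borel_rV R n) R U); last exact: (@measurable_sphere R n).
  by rewrite unifU.1 subee.
move=> x /= h; apply: contra_not h => xS _.
by rewrite sqr_enorm (@sphere_dot R n x).1.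
Qed.

Lemma moment_uniform : moment2 U.
Proof. by rewrite /moment2 integral_uniform_norm2 ltry. Qed.

Lemma expect_uniform_norm2 : expect U (fun x => dot x x) = 1.
Proof.
rewrite /expect /Rintegral; under eq_integral do rewrite -sqr_enorm.
by rewrite integral_uniform_norm2.
Qed.

Lemma moment_flow t : 0 <= t -> moment2 (rho t).
Proof. exact: flow_moment flow t. Qed.

Lemma force_le t : enorm (force t) <= S.
Proof. exact: ls_grad ls _. Qed.

Lemma flow_cvg0 f : test_function f ->
  (fun t => expect (rho t) f) @ 0^'+ --> expect (rho 0) f.
Proof. exact: flow_init flow f. Qed.

Lemma flow_derive f c t : (forall x, differentiable f x) ->
  (forall x, enorm (grad f x) <= c * enorm x) -> 0 < t ->
  is_derive t 1 (fun s => expect (rho s) f)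
    (- sigma * expect (rho t) f + sigma * expect U f
     - expect (rho t) (fun x => dot (grad f x) (grad (pot t) x))).
Proof.
move=> df gf t0; have tf : test_function f by exact: test_of_grad_le gf.
have := flow_eq flow tf t0; rewrite -/(expect _ _).
congr is_derive; congr (_ + _).
rewrite -mulN1r -expectZ//; first last.
- apply: (quadratic_grad2 f (pot t) c (5 * S ^+ 3)) => // x.
    exact: (diff_potential ls).
  exact: (grad_potential_le ls _ _ (force_le t)).
- exact/moment_flow/ltW.
by rewrite /expect; congr Rintegral; apply/funext => x; rewrite mulN1r dotNr.
Qed.

Lemma derivable_mean t : 0 < t -> derivable mean t 1.
Proof.
move=> t0; apply/derivable_mxP => i j; rewrite (ord1 i).
under eq_fun do rewrite /mean mean_coord.
have := flow_derive _ _ t (diff_dotPhi ls (delta_mx ord0 j))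
   (grad_dotPhi_le ls (delta_mx ord0 j)) t0.
by move=> /@ex_derive.
Qed.

Lemma cvg_mean0 : mean @ 0^'+ --> mean 0.
Proof.
apply: cvg_rV => i; under eq_fun do rewrite /mean mean_coord.
by rewrite /mean mean_coord; apply: flow_cvg0; exact: (test_dotPhi ls).
Qed.

(** At time [t] the derivative of [Rf \o mean] is that of the linear function [dot (force t)] of the
    mean. The loss thus has the same derivative as the expectation of the fixed test function
    [pot t], whose transport term is its own squared gradient. *)
Lemma energy_derive t : 0 < t ->
  is_derive t 1 L (- sigma * expect (rho t) (pot t) + sigma * expect U (pot t)
    - dissipation t).
Proof.
move=> t0.
have dm := derivable_mean t t0.
have dR := is_derive_comp_rV mean Rf t dm (ls_diff _ _ _ _ ls (mean t)).
have did : differentiable (@id 'rV[R]_k) (mean t).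
  by have := is_diff_id (mean t) => /@ex_diff.
have idl := is_diff_dot id (force t) (mean t) did.
have dl : differentiable (fun y : 'rV[R]_k => dot (force t) y) (mean t).
  by have := idl => /@ex_diff.
have dA := is_derive_comp_rV mean (fun y => dot (force t) y) t dm dl.
have eA : 'd (fun y : 'rV[R]_k => dot (force t) y) (mean t) ('D_1 mean t) =
    'd Rf (mean t) ('D_1 mean t).
  rewrite [RHS]diff_grad; last exact: ls_diff ls _.
  have /@diff_val -> := idl.
  by have /@diff_val -> := is_diff_id (mean t).
rewrite eA in dA.
have dV := flow_derive _ _ t (ls_V_diff _ _ _ _ ls) (ls_V_grad _ _ _ _ ls) t0.
have dP := flow_derive _ _ t (diff_potential ls (force t))
  (fun x => grad_potential_le ls (force t) x (force_le t)) t0.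
have dL := @is_deriveD _ _ _ _ _ _ _ _ _ dR dV.
have dAV := @is_deriveD _ _ _ _ _ _ _ _ _ dA dV.
have dAV' : is_derive t 1 ((fun y => dot (force t) y) \o mean + (fun s => expect (rho s) V))
   (- sigma * expect (rho t) (pot t) + sigma * expect U (pot t) - dissipation t).
  (* Exchanging [dot] and expectation uses the second moment of [rho s], which is known for
     [s >= 0]; near [t > 0] this holds. *)
  apply: near_eq_is_derive dP; near=> s.
  have m2 : moment2 (rho s).
    by apply: moment_flow; apply/ltW; near: s; exact: lt_nbhsr.
  rewrite /potential expectD//; [|exact: (quadratic_dotPhi ls)|exact: (quadratic_V ls)].
  by rewrite -(dot_mean ls).
have := @derive_val _ _ _ _ _ _ _ dAV'; have := @derive_val _ _ _ _ _ _ _ dAV => -> e.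
by rewrite -e.
Unshelve. all: by end_near. Qed.


Lemma loss_cvg0 : L @ 0^'+ --> L 0.
Proof.
apply: cvgD; last exact: (flow_cvg0 V (test_V ls)).
apply: continuous_cvg; last exact: cvg_mean0.
by apply: differentiable_continuous; exact: ls_diff ls _.
Qed.

Lemma loss_continuous a b : 0 <= a -> {within `[a, b], continuous L}.
Proof.
apply: within_continuous_ge0 => [t t0|]; last exact: loss_cvg0.
by have := energy_derive t t0 => /@ex_derive.
Qed.

Hypothesis loss0 : L 0 <= 2 * S.

(** [Rf 0] is not among the parameters; the tangent at 0, evaluated at the initial mean, bounds it
    through the initial loss and second moment. *)
Lemma Rf0_le : Rf 0 <= 4 * S ^+ 4.
Proof.
have := ls_convex _ _ _ _ ls 0 (mean 0); rewrite subr0.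
have m0 := moment_flow 0 (lexx 0).
rewrite (dot_mean ls)// => h.
have hM := moment_le_loss ls _ m0.
have := expect_norm_le (rho 0) _ _ m0 (quadratic_dotPhi ls (grad Rf 0)).1
  (ls_Phi_bound _ _ _ _ ls (grad Rf 0)).
have g := ls_grad _ _ _ _ ls 0.
set M := expect (rho 0) _ in hM *; set E := expect (rho 0) _ in h *.
rewrite ler_norml => /andP[h1 _].
have hV : 0 <= expect (rho 0) V by apply: expect_ge0; exact: V_ge0 ls.
have M0 : 0 <= M by apply: expect_ge0 => x; exact: dot_ge0.
have hM2 : M <= 2 * S ^+ 2.
  apply: (le_trans hM); have -> : 2 * S ^+ 2 = S * (2 * S) by ring.
  by rewrite ler_pM2l.
have k1 : S * enorm (grad Rf 0) * M <= S * S * (2 * S ^+ 2).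
  by apply: ler_pM => //; rewrite ?mulr_ge0 ?enorm_ge0 ?ler_pM2l// ltW.
have hR : Rf (mean 0) <= 2 * S by have := loss0; rewrite /L /loss_val -/(mean 0); lra.
have k2 : S <= S ^+ 4.
  by rewrite -{1}[S]expr1; apply: ler_weXn2l.
have -> : 4 * S ^+ 4 = S * S * (2 * S ^+ 2) + 2 * S ^+ 4 by ring.
move: h h1 k1 hR k2; set q := _ * M; set w := S * S * _; lra.
Qed.

(** Mass removed by the noise costs [- expect (rho t) (pot t)]. Convexity between [mean t] and 0
    bounds this by [Rf 0], before the second moment of [rho t] is under control; [4 S ^ 4 + 2 S ^ 2]
    gives the 6. *)
Lemma energy_le t : 0 < t ->
  exists2 l, is_derive t 1 L l & l <= 6 * S ^+ 4 * sigma - dissipation t.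
Proof.
move=> t0; eexists; first exact: energy_derive.
rewrite lerD2r.
have m2 := moment_flow t (ltW t0).
have h1 : - expect (rho t) (pot t) <= 4 * S ^+ 4.
  apply: le_trans Rf0_le; have := ls_convex _ _ _ _ ls (mean t) 0.
  rewrite sub0r dotNr (dot_mean ls)//.
  rewrite /pot /potential expectD//; [|exact: (quadratic_dotPhi ls)|exact: (quadratic_V ls)].
  have hV : 0 <= expect (rho t) V by apply: expect_ge0; exact: V_ge0 ls.
  have hR := ls_ge0 _ _ _ _ ls (mean t).
  by rewrite -/(force t); set q := expect _ _ in hV *; set w := expect _ (fun x => dot _ _); lra.
have h2 : expect U (pot t) <= 2 * S ^+ 2.
  have := expect_norm_le U (pot t) (2 * S ^+ 2) moment_uniform
    (quadratic_potential ls (force t)).1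
    (fun x => potential_le ls (force t) x (force_le t)).
  by rewrite expect_uniform_norm2 mulr1 => /(le_trans (ler_norm _)).
have h3 : S ^+ 2 <= S ^+ 4 by apply: ler_weXn2l.
have -> : - sigma * expect (rho t) (pot t) + sigma * expect U (pot t) =
  (- expect (rho t) (pot t) + expect U (pot t)) * sigma by ring.
by rewrite ler_pM2r//; lra.
Qed.

Lemma loss_decay s t c : 0 <= s -> s <= t ->
  (forall u, s < u < t -> c <= dissipation u) ->
  L t <= L s + (6 * S ^+ 4 * sigma - c) * (t - s).
Proof.
move=> s0 st hc; rewrite -lerBlDl.
have pos u : s < u < t -> 0 < u by move=> /andP[su _]; exact: le_lt_trans su.
apply: (le_of_derive_le L (fun u => 'D_1 L u)) => //.
- by move=> u /pos /energy_derive /@ex_derive; exact: derivableP.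
- exact: loss_continuous.
- move=> u ut; have [l dl ll] := energy_le u (pos u ut).
  have /@derive_val -> := dl; apply: (le_trans ll).
  by rewrite lerD2l lerN2 hc.
Qed.

Lemma dissipation_ge0 t : 0 <= dissipation t.
Proof. by apply: expect_ge0 => x; exact: dot_ge0. Qed.

Lemma loss_growth s t : 0 <= s -> s <= t -> L t <= L s + 6 * S ^+ 4 * sigma * (t - s).
Proof.
move=> s0 st; have := loss_decay s t 0 s0 st; rewrite subr0; apply.
by move=> u _; exact: dissipation_ge0.
Qed.

Context {T : R}.
Hypothesis loss_bound : forall t, 0 <= t <= T -> L t <= 3 * S.

Lemma moment_bound t : 0 <= t <= T -> expect (rho t) (fun x => dot x x) <= 3 * S ^+ 2.
Proof.
move=> tT; have /andP[t0 _] := tT.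
apply: (le_trans (moment_le_loss ls _ (moment_flow t t0))).
have -> : 3 * S ^+ 2 = S * (3 * S) by ring.
by rewrite ler_pM2l//; exact: loss_bound.
Qed.

(* Young's inequality splits the speed of the mean into the dissipation, which
   the loss pays for, and a multiple of the elapsed time. *)
Lemma mean_displacement lam s t : 0 < lam -> 0 <= s -> s <= t -> t <= T ->
  enorm (mean t - mean s) <=
    (4 * sigma * S ^+ 3 + 6 * lam * S ^+ 4 + 12 * sigma * S ^+ 6 / lam) * (t - s)
    + 2 * S ^+ 2 / lam * (L s - L t).
Proof.
move=> lam0 s0 st tT.
set A := _ + _ + _; set K := 2 * S ^+ 2 / lam.
have K0 : 0 < K by rewrite divr_gt0// mulr_gt0// exprn_gt0.
have K6 : K * (6 * S ^+ 4 * sigma) = 12 * sigma * S ^+ 6 / lam.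
  by rewrite /K; field; rewrite gt_eqF.
apply: enorm_le_dual => [u u1|]; last first.
  (* Side condition of the duality: the bound is nonnegative, because the loss grows at most by the
     noise and the last summand of [A] compensates for that. *)
  have h := loss_growth s t s0 st.
  have hK : K * (L t - L s) <= K * (6 * S ^+ 4 * sigma * (t - s)).
    by rewrite ler_pM2l//; lra.
  rewrite mulrA K6 in hK.
  have h1 : 0 <= 4 * sigma * S ^+ 3 * (t - s).
    by rewrite !mulr_ge0 ?subr_ge0 ?exprn_ge0// ltW.
  have h2 : 0 <= 6 * lam * S ^+ 4 * (t - s).
    by rewrite !mulr_ge0 ?subr_ge0 ?exprn_ge0// ltW.
  by move: hK h1 h2; rewrite /A; set q := _ / lam; lra.
have m2 r : 0 <= r -> moment2 (rho r) by exact: moment_flow.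
have t0 : 0 <= t by exact: le_trans st.
rewrite dotBr !(dot_mean ls); [|exact: m2..].
set G := fun r => expect (rho r) (fun x => dot u (Phi x)).
rewrite -lerBlDr.
(* [K] is chosen so that, in the derivative of [G + K L], the dissipation produced by Young's
   inequality cancels the one lost by the energy. *)
have -> : G t - G s - K * (L s - L t) = (G + K \*: L) t - (G + K \*: L) s.
  rewrite -[(G + K \*: L) t]/(G t + K * L t) -[(G + K \*: L) s]/(G s + K * L s).
  by ring.
have pos r : s < r < t -> 0 < r by move=> /andP[sr _]; exact: le_lt_trans sr.
pose dG (r : R) (r0 : 0 < r) :=
  flow_derive _ _ r (diff_dotPhi ls u) (grad_dotPhi_le ls u) r0.
have dGL r : 0 < r -> derivable (G + K \*: L) r 1.
  move=> r0; apply: derivableD; first by have /@ex_derive := dG r r0.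
  by apply: derivableZ; have /@ex_derive := energy_derive r r0.
apply: (le_of_derive_le _ (fun r => 'D_1 (G + K \*: L) r)) => //.
- by move=> r /pos /dGL; exact: derivableP.
- apply: within_continuous_ge0 => //.
  apply: cvgD; first exact: (flow_cvg0 _ (test_dotPhi ls u)).
  exact: (cvgM (cvg_cst K) loss_cvg0).
move=> r rr; have r0 := pos r rr; have rT : 0 <= r <= T.
  by rewrite ltW//= ltW// (lt_le_trans _ tT)//; case/andP: rr.
have [l dl ll] := energy_le r r0.
have := @is_deriveD _ _ _ _ _ _ _ _ _ (dG r r0) (@is_deriveZ _ _ _ _ K _ _ _ dl).
move=> /@derive_val ->.
have M3 := moment_bound r rT; have mr := m2 r (ltW r0).
have M0 : 0 <= expect (rho r) (fun x => dot x x) by apply: expect_ge0 => x; exact: dot_ge0.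
have b1 : - expect (rho r) (fun x => dot u (Phi x)) <= 3 * S ^+ 3.
  have := expect_norm_le (rho r) _ _ mr (quadratic_dotPhi ls u).1 (ls_Phi_bound _ _ _ _ ls u).
  rewrite u1 mulr1 ler_norml lerNl => /andP[h _].
  apply: (le_trans h).
  have -> : 3 * S ^+ 3 = S * (3 * S ^+ 2) by ring.
  by rewrite (ler_pM2l S0); exact: M3.
have b2 : expect U (fun x => dot u (Phi x)) <= S ^+ 3.
  have := expect_norm_le U _ _ moment_uniform (quadratic_dotPhi ls u).1 (ls_Phi_bound _ _ _ _ ls u).
  rewrite u1 mulr1 expect_uniform_norm2 mulr1 => /(le_trans (ler_norm _)) /le_trans; apply.
  by rewrite -{1}[S]expr1; apply: ler_weXn2l.
have b3 : - expect (rho r) (fun x => dot (grad (fun x => dot u (Phi x)) x) (grad (pot r) x)) <=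
    6 * lam * S ^+ 4 + K * dissipation r.
  have q1 : quadratic (fun x => dot (grad (fun x => dot u (Phi x)) x) (grad (pot r) x)).
    apply: quadratic_grad2 (grad_dotPhi_le ls u) _ => //.
    - exact: (diff_dotPhi ls).
    - exact: (diff_potential ls).
    - by move=> x; exact: (grad_potential_le ls _ x (force_le r)).
  have q2 : quadratic (fun x => dot (grad (pot r) x) (grad (pot r) x)).
    apply: (quadratic_grad2 _ _ (5 * S ^+ 3) (5 * S ^+ 3)).
    - exact: (diff_potential ls).
    - exact: (diff_potential ls).
    - by move=> x; exact: (grad_potential_le ls _ x (force_le r)).
    - by move=> x; exact: (grad_potential_le ls _ x (force_le r)).
  apply: (@le_trans _ _ (expect (rho r) (fun x => 2 * S ^+ 2 * lam * dot x x +
      K * dot (grad (pot r) x) (grad (pot r) x)))).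
    rewrite -mulN1r -expectZ//; apply: expect_le => //.
    - exact: quadraticZ.
    - by apply: quadraticD; apply: quadraticZ => //; exact: quadratic_norm2.
    move=> x; rewrite mulN1r; apply: (le_trans (ler_norm _)); rewrite normrN.
    apply: (le_trans (cauchy_schwarz _ _)).
    have := grad_dotPhi_le ls u x; rewrite u1 mulr1 => hx.
    apply: (@le_trans _ _ (4 * S ^+ 2 * (enorm x * enorm (grad (pot r) x)))).
      by rewrite mulrA ler_wpM2r ?enorm_ge0.
    rewrite -!sqr_enorm; set e := enorm x; set g := enorm _.
    rewrite -subr_ge0.
    have -> : 2 * S ^+ 2 * lam * e ^+ 2 + K * g ^+ 2 - 4 * S ^+ 2 * (e * g) =
      2 * S ^+ 2 / lam * (lam * e - g) ^+ 2 by rewrite /K; field; rewrite gt_eqF.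
    by rewrite mulr_ge0 ?sqr_ge0// ltW.
  rewrite expectD//; [|by apply: quadraticZ; exact: quadratic_norm2|exact: quadraticZ].
  rewrite !expectZ//; last exact: quadratic_norm2.
  rewrite lerD2r.
  have -> : 6 * lam * S ^+ 4 = 2 * S ^+ 2 * lam * (3 * S ^+ 2) by ring.
  by rewrite ler_pM2l// !mulr_gt0// exprn_gt0.
have b4 : K * l <= 12 * sigma * S ^+ 6 / lam - K * dissipation r.
  by rewrite -K6 -mulrBr ler_pM2l.
have b5 : - sigma * expect (rho r) (fun x => dot u (Phi x)) <= sigma * (3 * S ^+ 3).
  by rewrite mulNr -mulrN ler_pM2l.
have b6 : sigma * expect U (fun x => dot u (Phi x)) <= sigma * S ^+ 3.
  by rewrite ler_pM2l.
rewrite /A -[K *: l]/(K * l); move: b3 b4 b5 b6.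
have -> : 4 * sigma * S ^+ 3 = sigma * (3 * S ^+ 3) + sigma * S ^+ 3 by ring.
set k1 := K * l; set k2 := _ / lam; set k3 := K * _; set k4 := 6 * lam * _.
set e1 := expect _ _; set e2 := - sigma * _; set e3 := sigma * expect _ _.
set e4 := sigma * (3 * _); set e5 := sigma * S ^+ 3. lra.
Qed.

Lemma force_displacement lam s t : 0 < lam -> 0 <= s -> s <= t -> t <= T ->
  enorm (force t - force s) <=
    S * ((4 * sigma * S ^+ 3 + 6 * lam * S ^+ 4 + 12 * sigma * S ^+ 6 / lam) * (t - s)
    + 2 * S ^+ 2 / lam * (L s - L t)).
Proof.
move=> lam0 s0 st tT; apply: (le_trans (ls_lip _ _ _ _ ls _ _)).
by rewrite ler_pM2l//; exact: mean_displacement.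
Qed.

End flow.

(** * Mass in directions of negative potential *)

Lemma differentiable_of_expansion {R : realType} {V W : normedModType R} (f : V -> W)
  (df : {linear V -> W}) (x : V) :
  continuous df -> f \o shift x = cst (f x) + df +o_ 0 id -> differentiable f x.
Proof.
by move=> cdf o; apply/diff_locallyP; rewrite (diff_unique cdf o); split.
Qed.

Section well_calculus.
Context {R : realType}.

Lemma differentiable_norm2 {n : nat} (x : 'rV[R]_n) :
  differentiable (fun x : 'rV[R]_n => dot x x) x.
Proof.
rewrite (_ : (fun _ => _) = \sum_(i < n) (fun x : 'rV[R]_n => x ord0 i * x ord0 i)).
  apply: differentiable_sum => i; apply: differentiableM; exact: differentiable_coord.
by apply/funext => y; rewrite fct_sumE.
Qed.

Lemma diff_norm2 {n : nat} (x u : 'rV[R]_n) :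
  'd (fun x : 'rV[R]_n => dot x x) x u = 2 * dot x u.
Proof.
have df : differentiable (fun x : 'rV[R]_n => dot x x) (x + 0 *: u).
  exact: differentiable_norm2.
have := is_derive_line (fun x : 'rV[R]_n => dot x x) x u 0 df.
rewrite scale0r addr0 => /@derive_val <-.
have -> : (fun s : R => dot (x + s *: u) (x + s *: u)) =
    (fun s => dot x x + 2 * dot x u * s + dot u u * s ^+ 2).
  apply/funext => s; rewrite dotDl !dotDr !dotZl !dotZr (dotC u x); ring.
by rewrite (@derive_val _ _ _ _ _ _ _ (is_derive_quadratic _ _ _ _)); ring.
Qed.

(** Squaring the positive part removes its corner: the error of the linear approximation is at most
    [h ^ 2] in every sign case. Hence the square in [well]. *)
Lemma is_derive_sqr_pos (y : R) :
  is_derive y 1 (fun y : R => Num.max y 0 ^+ 2) (2 * Num.max y 0).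
Proof.
have bound (h : R) : `|Num.max (h + y) 0 ^+ 2 - Num.max y 0 ^+ 2 - 2 * Num.max y 0 * h| <= h ^+ 2.
  have := sqr_ge0 h; have := sqr_ge0 (h + y); have := sqr_ge0 y.
  case: (leP y 0) => y0; case: (leP (h + y) 0) => hy0 ? ? ?; rewrite ler_norml; apply/andP; split; nra.
have c : (fun h : R => h^-1 *: (((fun y : R => Num.max y 0 ^+ 2) \o shift y) (h *: (1 : R)) -
    Num.max y 0 ^+ 2)) @ 0^' --> 2 * Num.max y 0.
  apply/cvgrPdist_le => e e0; near=> h.
  have h0 : h != 0 by near: h; exact: nbhs_dnbhs_neq.
  have he : `|h| <= e by near: h; exact: dnbhs0_le.
  rewrite /= [_ *: 1]mulr1 distrC /GRing.scale/=.
  have -> : h^-1 * (Num.max (h + y) 0 ^+ 2 - Num.max y 0 ^+ 2) - 2 * Num.max y 0 =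
     h^-1 * (Num.max (h + y) 0 ^+ 2 - Num.max y 0 ^+ 2 - 2 * Num.max y 0 * h).
    by field.
  rewrite normrM normfV ler_pdivrMl ?normr_gt0// (le_trans (bound h))//.
  by rewrite -real_normK ?num_real// expr2 ler_wpM2l.
apply: DeriveDef; first by apply/cvg_ex; eexists; exact: c.
exact/cvg_lim.
Unshelve. all: by end_near. Qed.

(** For the origin, where [well] is a quotient with zero denominator: quadratic smallness alone
    gives derivative 0. *)
Lemma diff0_of_sqr_bound {n : nat} (f : 'rV[R]_n -> R) (c : R) :
  (forall x, `|f x| <= c * dot x x) -> differentiable f 0.
Proof.
move=> fc.
have f0 : f 0 = 0 by apply/eqP; rewrite -normr_le0 (le_trans (fc 0))// dot0l mulr0.
apply: (@differentiable_of_expansion R _ _ f (\0 : {linear 'rV[R]_n -> R}) 0).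
  exact: cst_continuous.
apply/eqaddoP => _/posnumP[e]; near=> h.
rewrite -![(_ - _ : _ -> _) _]/(_ - _) -![(_ + _ : _ -> _) _]/(_ + _) /= f0 !addr0 subr0.
have nn : dot h h <= n%:R * `|h| ^+ 2.
  rewrite -[n in n%:R]card_ord mulr_natl -sumr_const; apply: ler_sum => i _.
  rewrite -expr2 -real_normK ?num_real// ler_pXn2r ?nnegrE//.
  by rewrite [leRHS]/Num.Def.normr/= mx_normrE; exact: (le_bigmax _ _ (ord0, i)).
apply: (le_trans (fc h)); apply: (@le_trans _ _ (`|c| * (n%:R * `|h| ^+ 2))).
  apply: (@le_trans _ _ (`|c| * dot h h)); last by rewrite ler_wpM2l.
  by rewrite ler_wpM2r ?dot_ge0 ?ler_norm.
have k0 : 0 < `|c| * n%:R + 1 by rewrite ltr_wpDl// mulr_ge0.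
have hk : `|h| <= e%:num / (`|c| * n%:R + 1).
  near: h; apply/nbhs_ballP; exists (e%:num / (`|c| * n%:R + 1)); first exact: divr_gt0.
  by move=> y; rewrite -ball_normE /ball_/= sub0r normrN => /ltW.
rewrite expr2 !mulrA ler_wpM2r//.
apply: (@le_trans _ _ ((`|c| * n%:R + 1) * `|h|)); first by rewrite ler_wpM2r// lerDl.
by rewrite mulrC -ler_pdivlMr.
Unshelve. all: by end_near. Qed.

(** Take the supremum of the times up to which [P] holds throughout: [left] shows that [P] holds
    there, and [right] that it cannot lie below [b]. This serves a function of time that is not
    known to be continuous. *)
Lemma real_induction (P : R -> Prop) (a b : R) : a <= b -> P a ->
  (forall t, a <= t < b -> P t -> exists2 e, 0 < e & forall s, t < s < t + e -> P s) ->
  (forall t, a < t <= b -> (forall s, a <= s < t -> P s) -> P t) ->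
  P b.
Proof.
move=> ab Pa right left.
set E := [set t | a <= t <= b /\ forall s, a <= s <= t -> P s].
have Ea : E a.
  split; first by rewrite lexx.
  by move=> s; rewrite -eq_le => /eqP <-.
have hs : has_sup E by split; [exists a|exists b => t [/andP[]]].
set c := sup E.
have ac : a <= c by apply: sup_upper_bound.
have cb : c <= b by apply: ge_sup; [exists a|move=> t [/andP[]]].
have below s : a <= s < c -> P s.
  move=> /andP[sa sc]; have e0 : 0 < c - s by rewrite subr_gt0.
  have [t [tab Et] st] := sup_adherent e0 hs.
  by apply: Et; rewrite sa/= ltW//; move: st; rewrite opprB addrCA subrr addr0.
have Pc : P c.
  move: (ac); rewrite le_eqVlt => /predU1P[<-//|ac'].
  by apply: left => //; rewrite ac'.
have [cb'|] := ltP c b; last by move=> bc; rewrite (@le_anti _ _ b c) // bc cb.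
have [e e0 he] := right c (introT andP (conj ac cb')) Pc.
set s := Num.min (c + e / 2) b.
have cs : c < s by rewrite lt_min cb' ltrDl divr_gt0.
have : s <= c.
  apply: sup_upper_bound => //; split.
    by rewrite (le_trans ac (ltW cs))/= ge_min lexx orbT.
  move=> r /andP[ra rs]; have [rc|cr|->//] := ltgtP r c.
    by apply: below; rewrite ra.
  apply: he; rewrite cr/= (le_lt_trans rs)// gt_min; apply/orP; left.
  by rewrite ltrD2l ltr_pdivrMr// ltr_pMr// ltr1n.
by rewrite leNgt cs.
Qed.

End well_calculus.

Section well.
Context {R : realType} {n : nat} (p : 'rV[R]_n -> R).
Hypotheses (hom : homogeneous2 (p : 'rV[R]_n -> R^o)).
Hypothesis (dp : forall x, differentiable p x).
Implicit Types (x u : 'rV[R]_n) (delta : R).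

Definition excess delta x : R := - p x - delta * dot x x.

(** A differentiable stand-in for the squared norm cut off to the cone of directions with potential
    below [- delta]. On the sphere it is the squared positive part of [- p - delta]; dividing by
    [dot x x] restores degree 2, and division by zero gives 0 at the origin. *)
Definition well delta x : R := Num.max (excess delta x) 0 ^+ 2 / dot x x.

Lemma well_ge0 delta x : 0 <= well delta x.
Proof. by rewrite divr_ge0 ?sqr_ge0 ?dot_ge0. Qed.

Lemma differentiable_excess delta x : differentiable (excess delta) x.
Proof.
apply: (@differentiableB _ _ _ (fun x => - p x) (fun x => delta * dot x x)).
  exact: differentiableN.
exact: (differentiableZ delta (differentiable_norm2 x)).
Qed.

Lemma diff_excess delta x u :
  'd (excess delta) x u = - 'd p x u - 2 * delta * dot x u.
Proof.
have dn := differentiable_norm2 x.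
have e : 'd (excess delta) x = 'd (- p) x \- 'd (delta *: (fun x : 'rV[R]_n => dot x x)) x :> (_ -> _).
  by apply: diffB; [exact: differentiableN|exact: differentiableZ].
have e0 : 'd (excess delta) x u =
    'd (- p) x u - 'd (delta *: (fun x : 'rV[R]_n => dot x x)) x u := congr1 (@^~ u) e.
have e1 : 'd (- p) x u = - 'd p x u := congr1 (@^~ u) (diffN (dp x)).
have e2 : 'd (delta *: (fun x : 'rV[R]_n => dot x x)) x u =
    delta * 'd (fun x : 'rV[R]_n => dot x x) x u := congr1 (@^~ u) (diffZ delta dn).
have e3 := etrans e2 (congr1 ( *%R delta) (diff_norm2 x u)).
apply: (etrans e0); apply: (etrans (congr2 (fun a b => a - b) e1 e3)).
by rewrite mulrCA mulrA.
Qed.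

Lemma diff_sqr_excess delta x :
  is_diff x (fun x => Num.max (excess delta x) 0 ^+ 2)
    (fun u => 2 * Num.max (excess delta x) 0 * 'd (excess delta) x u).
Proof.
set sq := fun y : R => Num.max y 0 ^+ 2.
have dE := differentiable_excess delta x.
have dsq : differentiable sq (excess delta x).
  by apply/derivable1_diffP; have /@ex_derive := is_derive_sqr_pos (excess delta x).
rewrite -[fun x => _]/(sq \o excess delta).
apply: DiffDef; first exact: differentiable_comp.
apply/funext => u; rewrite diff_comp//= diff1E//= derive1E.
by rewrite (@derive_val _ _ _ _ _ _ _ (is_derive_sqr_pos _)) -[_ *: _]/(_ * _) mulrC.
Qed.

Lemma abs_well_le delta c x : 0 <= delta -> (forall y, `|p y| <= c * dot y y) ->
  `|well delta x| <= c ^+ 2 * dot x x.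
Proof.
move=> d0 pc; rewrite ger0_norm ?well_ge0// /well.
have [->|x0] := eqVneq x 0; first by rewrite dot0l invr0 !mulr0.
have r0 : 0 < dot x x by rewrite dot_gt0.
rewrite ler_pdivrMr// -mulrA -expr2 -exprMn.
have h := pc x; have c0 : 0 <= c * dot x x by exact: le_trans h.
rewrite ler_pXn2r ?nnegrE ?le_max ?lexx ?orbT//.
rewrite ge_max c0 andbT /excess.
have : 0 <= delta * dot x x by rewrite mulr_ge0// ltW.
by move: h; rewrite ler_norml; lra.
Qed.

Lemma differentiable_well delta c x : 0 <= delta ->
  (forall y, `|p y| <= c * dot y y) -> differentiable (well delta) x.
Proof.
move=> d0 pc; have [->|x0] := eqVneq x 0.
  apply: (@diff0_of_sqr_bound _ _ _ (c ^+ 2)) => y; exact: abs_well_le.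
rewrite /well; apply: differentiableM.
  by have /@ex_diff := diff_sqr_excess delta x.
apply: differentiableV; first exact: differentiable_norm2.
by rewrite dot_eq0.
Qed.

(** The product rule for [well] times the squared norm, which equals the squared positive part of
    the excess; no quotient has to be differentiated. *)
Lemma diff_well delta c x u : 0 <= delta -> (forall y, `|p y| <= c * dot y y) ->
  x != 0 ->
  'd (well delta) x u * dot x x + 2 * well delta x * dot x u =
  2 * Num.max (excess delta x) 0 * 'd (excess delta) x u.
Proof.
move=> d0 pc x0; have db := differentiable_well delta c x d0 pc.
have dn := differentiable_norm2 x.
have E : (fun x => Num.max (excess delta x) 0 ^+ 2) = well delta * (fun x => dot x x).
  apply/funext => y; rewrite -[RHS]/(well delta y * dot y y) /well.
  have [->|y0] := eqVneq y 0; last by rewrite divfK// dot_eq0.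
  by rewrite dot0l mulr0 /excess dot0l mulr0 subr0 (hom0 _ hom) oppr0 maxxx expr0n.
have /@diff_val := diff_sqr_excess delta x; rewrite E => /(congr1 (@^~ u)) /= <-.
have e1 : 'd (well delta * (fun x => dot x x)) x u =
    well delta x * 'd (fun x : 'rV[R]_n => dot x x) x u + dot x x * 'd (well delta) x u :=
  congr1 (@^~ u) (diffM db dn).
apply: etrans (esym e1); apply: etrans (esym (congr1 (fun a => well delta x * a + _) (diff_norm2 x u))).
rewrite [RHS]addrC; congr (_ + _); first exact: mulrC.
by rewrite [RHS]mulrCA mulrA.
Qed.

Lemma well_homogeneous delta : homogeneous2 (well delta : 'rV[R]_n -> R^o).
Proof.
move=> c x; rewrite -[RHS]/(c ^+ 2 * _) /well /excess (homE _ hom) dotZl dotZr.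
have [->|c0] := eqVneq c 0; first by rewrite !mul0r invr0 !mulr0 expr0n /= mul0r.
have -> : - (c ^+ 2 * p x) - delta * (c * (c * dot x x)) =
  c ^+ 2 * (- p x - delta * dot x x) by ring.
set A := - p x - _.
have -> : Num.max (c ^+ 2 * A) 0 = c ^+ 2 * Num.max A 0.
  by rewrite maxr_pMr ?sqr_ge0// mulr0.
have [->|x0] := eqVneq x 0; first by rewrite dot0l !mulr0 invr0 !mulr0.
field; apply/andP; split; rewrite ?c0 ?dot_eq0//.
Qed.

(** Makes [well] an admissible test function for the flow; [C] enters no rate. *)
Lemma well_grad_le delta c c' : 0 <= delta -> (forall y, `|p y| <= c * dot y y) ->
  (forall y, enorm (grad p y) <= c' * enorm y) -> 0 <= c ->
  exists C, forall x, enorm (grad (well delta) x) <= C * enorm x.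
Proof.
move=> d0 pc gc c0.
exists (2 * c * (`|c'| + 2 * delta) + 2 * c ^+ 2) => x.
have db y : differentiable (well delta) y by exact: differentiable_well pc.
apply: (grad_le_sphere _ (well_homogeneous delta) db) => {}x xS.
have xx : dot x x = 1 by apply/sphere_dot.
apply: enorm_le_dual => [u u1|]; last first.
  by rewrite addr_ge0 ?mulr_ge0 ?addr_ge0 ?sqr_ge0// mulr_ge0.
have x0 : x != 0 by rewrite -dot_eq0 xx oner_neq0.
have xu : `|dot x u| <= 1.
  by rewrite (le_trans (cauchy_schwarz _ _))// xS u1 mulr1.
rewrite dotC -diff_grad//; have e := diff_well delta c x u d0 pc x0; rewrite xx mulr1 in e.
have -> : 'd (well delta) x u = 2 * Num.max (excess delta x) 0 * 'd (excess delta) x u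
   - 2 * well delta x * dot x u by rewrite -e addrK.
have hb := abs_well_le delta c x d0 pc; rewrite xx mulr1 in hb.
set m := Num.max _ _.
have m0 : 0 <= m by rewrite le_max lexx orbT.
have mc : m <= c.
  rewrite ge_max c0 andbT /excess xx mulr1.
  by have := pc x; rewrite xx mulr1 ler_norml => /andP[]; lra.
have h1 : `|'d (excess delta) x u| <= `|c'| + 2 * delta.
  rewrite diff_excess (le_trans (ler_normB _ _))// lerD//.
    rewrite normrN diff_grad// (le_trans (cauchy_schwarz _ _))// u1 mulr1.
    by rewrite (le_trans (gc x))// xS mulr1 ler_norm.
  rewrite normrM ger0_norm ?mulr_ge0// -[leRHS]mulr1 ler_wpM2l// mulr_ge0//.
apply: (le_trans (ler_norm _)); rewrite (le_trans (ler_normB _ _))// lerD//.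
  rewrite normrM ler_pM// ger0_norm ?mulr_ge0// ler_pM2l//.
by rewrite normrM -[leRHS]mulr1 ler_pM// normrM ger0_norm// ler_pM2l.
Qed.

(* The radial derivative of the potential is [2 p], so on the support of the
   well the squared gradient is at least [4 p^2 / |x|^2]: mass is attracted
   to directions of low potential at an exponential rate. *)
Lemma well_growth delta c x : 0 <= delta -> (forall y, `|p y| <= c * dot y y) ->
  4 * delta * well delta x <= - dot (grad (well delta) x) (grad p x).
Proof.
move=> d0 pc; have db y : differentiable (well delta) y by exact: differentiable_well pc.
have [->|x0] := eqVneq x 0.
  have -> : grad p 0 = 0.
    by have := grad_homZ _ hom dp 0 0; rewrite !scale0r.
  by rewrite dot0r /well dot0l invr0 !mulr0 oppr0.
have r0 : 0 < dot x x by rewrite dot_gt0.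
rewrite -dotNr -diff_grad//; set v := - grad p x.
have pv u : 'd p x u = - dot v u by rewrite diff_grad// dotNl opprK.
have ev := diff_well delta c x v d0 pc x0.
have xv : dot x v = - 2 * p x.
  by rewrite dotC -[LHS]opprK -pv euler_hom//; ring.
have cs := dot_sqr_le x v.
rewrite diff_excess pv xv in ev; rewrite xv in cs.
rewrite -(ler_pM2r r0).
have -> : 'd (well delta) x v * dot x x =
   2 * Num.max (excess delta x) 0 * (dot v v - 2 * delta * (- 2 * p x))
   - 2 * well delta x * (- 2 * p x).
  by apply/eqP; rewrite -subr_eq0; apply/eqP; move: ev; set w := 'd _ _ _; lra.
have br : well delta x * dot x x = Num.max (excess delta x) 0 ^+ 2.
  by rewrite /well divfK// gt_eqF.
set r := dot x x in r0 cs br *; set b := well delta x in br *.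
set q := dot v v in cs *.
rewrite -(ler_pM2r r0).
have -> : (2 * Num.max (excess delta x) 0 * (q - 2 * delta * (- 2 * p x)) - 2 * b * (- 2 * p x)) * r
  = 2 * Num.max (excess delta x) 0 * (r * q + 4 * delta * p x * r) + 4 * p x * (b * r) by ring.
have -> : 4 * delta * b * r * r = 4 * delta * r * (b * r) by ring.
rewrite br /excess -/r; case: (leP _ 0) => fx.
  by rewrite expr0n /= !mulr0 !mul0r addr0.
have gx : delta * r < - p x by lra.
have dr : 0 <= delta * r by rewrite mulr_ge0// ltW.
(* Write [f] for the excess. Cauchy-Schwarz gives [r q >= 4 p ^ 2], which leaves at least
   [- 4 p f ^ 2] on the right; this exceeds [4 delta r f ^ 2] by [4 f ^ 3]. *)
have k1 : 0 <= (- p x - delta * r) * (r * q - (- 2 * p x) ^+ 2).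
  by rewrite mulr_ge0 ?subr_ge0// ltW.
have k2 : 0 <= (- p x - delta * r) ^+ 2 * (- p x - delta * r).
  by rewrite mulr_ge0 ?sqr_ge0// ltW.
move: k1 k2; set f := - p x - delta * r; set g := p x; rewrite /f -/g; nra.
Qed.

End well.

Lemma is_derive_exp_growth {R : realType} (c tau t0 t : R) :
  is_derive t 1 (fun s => c * (expR (tau * (s - t0)) - 1))
    (c * (tau * expR (tau * (t - t0)))).
Proof.
have da : is_derive t 1 (fun s : R => tau * (s - t0)) tau.
  have := is_derive_quadratic (- (tau * t0)) tau 0 t; rewrite mulr0 mul0r addr0.
  by congr is_derive; apply/funext => s; ring.
have de := @is_derive1_comp _ expR (fun s => tau * (s - t0)) t _ _
  (is_derive_expR (tau * (t - t0))) da.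
rewrite -[fun s => _]/(c \*: ((expR \o (fun s : R => tau * (s - t0))) - cst 1)).
apply: is_derive_eq; rewrite subr0 -[_ *: _]/(_ * _) mulrC; ring.
Qed.

Lemma ler_drift {R : realFieldType} {q q' w a1 a2 v : R} : w <= q' -> a1 - a2 <= w ->
  - (a2 + v) - (q + q') <= - (a1 + v) - q.
Proof. lra. Qed.

(** * A direction of negative potential forces the loss to drop *)

Section concentration.
Context {R : realType} {n k : nat} {Rf : 'rV[R]_k -> R}
  {Phi : 'rV[R]_n -> 'rV[R]_k} {V : 'rV[R]_n -> R} {S : R}.
Hypothesis ls : landscape Rf Phi V S.
Context {U : distr R n}.
Hypothesis unifU : uniform_on_sphere U.
Context {sigma : R} {rho : R -> distr R n}.
Hypothesis sigma_gt0 : 0 < sigma.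
Hypothesis flow : perturbed_flow Rf Phi V sigma U rho.

Let S1 : 1 <= S. Proof. exact: ls_S ls. Qed.
Let S0 : 0 < S. Proof. exact: lt_le_trans S1. Qed.

Let mean t := meanPhi Phi (rho t).
Let force t := grad Rf (mean t).
Let pot t := potential (Phi := Phi) (V := V) (force t).
Let L t := loss_val (Rf := Rf) (Phi := Phi) (V := V) (rho t).

Hypothesis loss0 : L 0 <= 2 * S.
Context {T : R}.
Hypothesis loss_bound : forall t, 0 <= t <= T -> L t <= 3 * S.

Let pot_le t x : `|pot t x| <= 2 * S ^+ 2 * dot x x.
Proof. exact: (potential_le ls _ x (force_le ls t)). Qed.

Let dpot t x : differentiable (pot t) x.
Proof. exact: (diff_potential ls). Qed.

Let quadratic_well t delta : 0 <= delta -> quadratic (well (pot t) delta).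
Proof.
move=> d0; apply: (quadratic_bound _ ((2 * S ^+ 2) ^+ 2)).
  by apply: differentiable_meas => x; exact: (differentiable_well _ (dpot t) _ _ _ d0 (pot_le t)).
by move=> x; exact: abs_well_le.
Qed.

(** On the cap of radius [tau / (16 S ^ 3)] around [z], the Lipschitz constant [2 S ^ 3] lets the
    potential rise by at most [tau / 8], so it stays [tau / 8] below the threshold [- 3 / 4 tau]. *)
Lemma uniform_well_lower z t tau : sphere R n z -> 0 < tau -> tau <= 1 ->
  pot t z <= - tau ->
  (tau / 8) ^+ 2 * (tau / (256 * S ^+ 3)) ^+ n <=
    expect U (well (pot t) (3 / 4 * tau)).
Proof.
move=> zS t0 t1 pz; set eta := tau / (16 * S ^+ 3).
have S3 : 1 <= S ^+ 3 by rewrite exprn_ege1.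
have eta0 : 0 < eta by rewrite divr_gt0// mulr_gt0// (lt_le_trans _ S3).
have eta1 : eta <= 1 by rewrite ler_pdivrMr ?mul1r ?mulr_gt0// ?(lt_le_trans _ S3)//; lra.
have cb := cap_lower_bound U unifU z eta zS eta0 eta1.
have d0 : 0 <= 3 / 4 * tau by rewrite mulr_ge0 ?(ltW t0)//.
rewrite -lee_fin; apply: le_trans (expect_ge_set U _ ((tau / 8) ^+ 2) (cap z eta)
  (moment_uniform unifU) (quadratic_well t _ d0) (measurable_cap z eta) _ _ _).
- rewrite EFinM lee_pmul2l ?lte_fin ?exprn_gt0 ?divr_gt0//.
  have -> : tau / (256 * S ^+ 3) = eta / 16.
    by rewrite /eta; field; rewrite gt_eqF// (lt_le_trans _ S3).
  exact: cb.
- by move=> x; exact: well_ge0.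
- exact: sqr_ge0.
move=> x [xS xz]; have xx : dot x x = 1 by apply/sphere_dot.
rewrite /well xx divr1 ler_pXn2r ?nnegrE ?le_max ?lexx ?orbT//; last by rewrite divr_ge0// ltW.
apply/orP; left; rewrite /excess xx mulr1.
have h : pot t x - pot t z <= tau / 8.
  have := potential_lip ls (force t) x z (force_le ls t) xS zS.
  move=> /(le_trans (ler_norm _)) /le_trans; apply.
  apply: (@le_trans _ _ (2 * S ^+ 3 * eta)).
    by rewrite ler_pM2l// mulr_gt0// exprn_gt0.
  rewrite /eta le_eqVlt; apply/orP; left; apply/eqP; field.
  by rewrite gt_eqF.
lra.
Qed.

Let A lam := 4 * sigma * S ^+ 3 + 6 * lam * S ^+ 4 + 12 * sigma * S ^+ 6 / lam.
Let K lam := 2 * S ^+ 2 / lam.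

(* The threshold of the well is lowered as fast as the potential can move, so
   that the well only grows with time although the potential drifts. *)
Lemma well_monotone lam tau t0 s t : 0 < lam -> 0 <= t0 -> t0 <= s -> s <= t -> t <= T ->
  let delta r := 3 / 4 * tau - S ^+ 2 * (A lam * (r - t0) + K lam * (L t0 - L r)) in
  forall x, well (pot s) (delta s) x <= well (pot t) (delta t) x.
Proof.
move=> lam0 t00 t0s st tT delta x.
rewrite /well ler_wpM2r ?invr_ge0 ?dot_ge0//.
suff h : excess (pot s) (delta s) x <= excess (pot t) (delta t) x.
  have n0 e : 0 <= Num.max e 0 :> R by rewrite le_max lexx orbT.
  by rewrite ler_pXn2r ?nnegrE ?n0// ge_max n0 andbT le_max h.
have s0 : 0 <= s by exact: le_trans t0s.
have fd := force_displacement ls unifU sigma_gt0 flow loss0 loss_bound lam s t lam0 s0 st tT.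
have := ls_Phi_bound _ _ _ _ ls (force t - force s) x.
set w := S * _ * _ => hw.
have hw2 : w <= S ^+ 2 * (A lam * (t - s) + K lam * (L s - L t)) * dot x x.
  rewrite /w ler_wpM2r ?dot_ge0// expr2 -mulrA ler_pM2l//.
move: hw; rewrite dotBl ler_norml => /andP[hw1 hw3].
rewrite /excess /pot /potential /delta -/(force _) -/(force _).
set e := A lam in hw2 *; set K' := K lam in hw2 *; set d := dot x x in hw2 *.
have -> : 3 / 4 * tau - S ^+ 2 * (e * (s - t0) + K' * (L t0 - L s)) =
  3 / 4 * tau - S ^+ 2 * (e * (t - t0) + K' * (L t0 - L t)) +
   S ^+ 2 * (e * (t - s) + K' * (L s - L t)) by ring.
rewrite mulrDl.
exact: (ler_drift hw2 hw3).
Qed.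

(** By contradiction: if the loss never falls by [Delta], the drift bound keeps the threshold of the
    well at least [tau / 2], and the integral of the well outgrows the limit [12 S ^ 6] that the
    second moment imposes. *)
Lemma loss_drops z lam tau Delta t0 t1 : sphere R n z ->
  0 < tau -> tau <= 1 -> 0 < t0 -> t0 <= t1 -> t1 <= T -> 0 < lam ->
  pot t0 z <= - tau -> sigma <= tau ->
  S ^+ 2 * (A lam * (t1 - t0) + K lam * Delta) <= tau / 4 ->
  12 * S ^+ 6 < sigma * ((tau / 8) ^+ 2 * (tau / (256 * S ^+ 3)) ^+ n) / (2 * tau)
                * (expR (tau * (t1 - t0)) - 1) ->
  exists2 t, t0 <= t <= t1 & L t <= L t0 - Delta.
Proof.
move=> zS tau0 tau1 t00 t01 t1T lam0 pz sigtau small large.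
have kappa0 : 0 < (tau / 8) ^+ 2 * (tau / (256 * S ^+ 3)) ^+ n.
  have S3 : 0 < 256 * S ^+ 3 by rewrite mulr_gt0 ?ltr0n ?exprn_gt0.
  by rewrite pmulr_rgt0 exprn_gt0 ?divr_gt0.
apply: contrapT => none.
have drop t : t0 <= t <= t1 -> L t0 - L t <= Delta.
  move=> tt; rewrite leNgt; apply/negP => h; apply: none.
  by exists t => //; rewrite lerBrDl -lerBrDr ltW.
set kappa := (tau / 8) ^+ 2 * (tau / (256 * S ^+ 3)) ^+ n in large kappa0.
set c := sigma * kappa / (2 * tau) in large.
have c0 : 0 < c by apply: divr_gt0; apply: mulr_gt0.
pose delta r := 3 / 4 * tau - S ^+ 2 * (A lam * (r - t0) + K lam * (L t0 - L r)).
have A0 : 0 <= A lam.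
  by rewrite /A !addr_ge0 ?mulr_ge0 ?exprn_ge0 ?invr_ge0 ?mulr_ge0// ltW.
have K0 : 0 <= K lam by rewrite /K mulr_ge0 ?invr_ge0 ?mulr_ge0 ?exprn_ge0// ltW.
have delta_ge t : t0 <= t <= t1 -> tau / 2 <= delta t.
  move=> tt; have h := drop t tt; case/andP: tt => ta tb.
  have : S ^+ 2 * (A lam * (t - t0) + K lam * (L t0 - L t)) <= tau / 4.
    apply: le_trans small; rewrite ler_pM2l ?exprn_gt0//.
    by rewrite lerD// ler_wpM2l// lerB.
  rewrite /delta; set q := S ^+ 2 * _; lra.
have delta_ge0 t : t0 <= t <= t1 -> 0 <= delta t.
  by move=> /delta_ge /(le_trans _); apply; rewrite divr_ge0// ltW.
have dt0 : delta t0 = 3 / 4 * tau by rewrite /delta !subrr !mulr0 addr0 mulr0 subr0.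
(* The well varies with [t] along with the measure, so [H] is never differentiated: [dwell] freezes
   the well at time [t]. *)
pose H t := expect (rho t) (well (pot t) (delta t)).
(* A comparison function, not a derivative: it solves the linear equation with rate [tau] and source
   [sigma * kappa / 2]. Halving the source leaves room for a strict inequality. *)
pose z' t := c * (expR (tau * (t - t0)) - 1).
have m2 t : t0 <= t -> moment2 (rho t).
  by move=> tt; apply: (moment_flow flow); apply: le_trans tt; exact: ltW.
have qw t : t0 <= t <= t1 -> quadratic (well (pot t) (delta t)).
  by move=> tt; exact/quadratic_well/delta_ge0.
have mono s t : t0 <= s -> s <= t -> t <= t1 ->
  forall x, well (pot s) (delta s) x <= well (pot t) (delta t) x.
  move=> a1 a2 a3 x; apply: (well_monotone lam tau t0 s t) => //; first exact: ltW.
  exact: le_trans t1T.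
have HU t : t0 <= t <= t1 -> kappa <= expect U (well (pot t) (delta t)).
  move=> /andP[ta tb]; apply: (le_trans (uniform_well_lower z t0 tau zS tau0 tau1 pz)).
  rewrite -dt0; apply: expect_le; [exact: (moment_uniform unifU)|apply: qw..|].
  - by rewrite lexx.
  - by rewrite ta.
  - by move=> x; exact: mono.
have dwell t : t0 <= t <= t1 ->
  exists2 l, is_derive t 1 (fun s => expect (rho s) (well (pot t) (delta t))) l &
    tau * H t + sigma * kappa <= l.
  move=> tt; have d0 := delta_ge0 t tt; have d1 := delta_ge t tt.
  have tpos : 0 < t by case/andP: tt => /(lt_le_trans t00).
  have c2 : 0 <= 2 * S ^+ 2 by rewrite mulr_ge0 ?exprn_ge0// ltW.
  have gp y : enorm (grad (pot t) y) <= 5 * S ^+ 3 * enorm y.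
    exact: (grad_potential_le ls _ y (force_le ls t)).
  have hp : homogeneous2 (pot t : 'rV[R]_n -> R^o) by exact: (hom_potential ls).
  have dw x : differentiable (well (pot t) (delta t)) x.
    exact: (differentiable_well _ (dpot t) _ _ x d0 (pot_le t)).
  have [C hC] := well_grad_le _ hp (dpot t) _ _ _ d0 (pot_le t) gp c2.
  have mt : moment2 (rho t) by apply: m2; case/andP: tt.
  eexists; first exact: (flow_derive ls flow _ C t dw hC tpos).
  have h1 : 4 * delta t * H t <=
     - expect (rho t) (fun x => dot (grad (well (pot t) (delta t)) x) (grad (pot t) x)).
    have q := quadratic_grad2 _ _ _ _ dw (dpot t) hC gp.
    rewrite -mulN1r -!expectZ//; last exact: qw.
    apply: expect_le => //; [exact/quadraticZ/qw|exact: quadraticZ|].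
    by move=> x; rewrite mulN1r; exact: (well_growth _ hp (dpot t) _ _ x d0 (pot_le t)).
  have h2 : sigma * kappa <= sigma * expect U (well (pot t) (delta t)).
    by rewrite ler_pM2l// HU.
  have H0 : 0 <= H t by apply: expect_ge0 => x; exact: well_ge0.
  (* [4 * delta t >= 2 * tau] and [sigma <= tau] leave the rate [tau]. *)
  have h3 : tau * H t <= (4 * delta t - sigma) * H t by rewrite ler_wpM2r//; lra.
  rewrite -/(force t) -/(pot t) -/(H t).
  move: h1 h2 h3; set q1 := expect _ (fun x => _); set q2 := sigma * expect _ _.
  lra.
have z'd t := is_derive_exp_growth c tau t0 t.
have key : z' t1 <= H t1.
  apply: (real_induction (fun t => z' t <= H t) t0 t1) => //.
  - rewrite /z' subrr mulr0 expR0 subrr mulr0; apply: expect_ge0 => x; exact: well_ge0.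
  - move=> t /andP[ta tb] Pt; have tt : t0 <= t <= t1 by rewrite ta ltW.
    have [l dl hl] := dwell t tt.
    have dF := @is_deriveB _ _ _ _ _ _ _ _ _ dl (z'd t).
    have := is_derive_right_gt _ _ _ dF.
    have -> : 0 < l - c * (tau * expR (tau * (t - t0))).
      have h : tau * z' t <= tau * H t by rewrite ler_pM2l.
      have e1 : c * (tau * expR (tau * (t - t0))) = tau * z' t + sigma * kappa / 2.
        by rewrite /z' /c; field; rewrite gt_eqF.
      have sk : 0 < sigma * kappa by rewrite mulr_gt0.
      rewrite e1; lra.
    move=> /(_ isT)[e e0 he]; exists (Num.min e (t1 - t)).
      by rewrite lt_min e0 subr_gt0.
    move=> s /andP[ts]; rewrite -ltrBlDl lt_min => /andP[se st1].
    have st : s <= t1 by lra.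
    have /he : t < s < t + e by rewrite ts/=; lra.
    rewrite -![(_ - _ : _ -> _) _]/(_ - _) -/(z' t) -/(z' s) -/(H t) => hs.
    apply: (@le_trans _ _ (expect (rho s) (well (pot t) (delta t)))).
      by move: hs Pt; lra.
    apply: expect_le; [apply: m2; lra|exact: qw|apply: qw; apply/andP; split; lra|].
    by move=> x; apply: mono => //; exact: ltW.
  - move=> t /andP[ta tb] Ps; have tt : t0 <= t <= t1 by rewrite tb ltW.
    rewrite leNgt; apply/negP => lt.
    have [l dl _] := dwell t tt.
    have dF := @is_deriveB _ _ _ _ _ _ _ _ _ dl (z'd t).
    have cF := differentiable_continuous ((derivable1_diffP _ _).1 (@ex_derive _ _ _ _ _ _ _ dF)).
    have Ft : expect (rho t) (well (pot t) (delta t)) - z' t < 0 by rewrite subr_lt0.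
    have nF : \forall s \near t, expect (rho s) (well (pot t) (delta t)) - z' s < 0 :=
      cvgr_lt _ cF 0 Ft.
    have [e /= e0 he] := (nbhs_ballP t _).1 (nF (nbhs_filter t)).
    pose s : R := Num.max (t - e / 2) ((t0 + t) / 2).
    have st : s < t by rewrite gt_max; apply/andP; split; lra.
    have ts : t0 < s by rewrite lt_max; apply/orP; right; lra.
    have es : t - e / 2 <= s by rewrite le_max lexx.
    have : expect (rho s) (well (pot t) (delta t)) - z' s < 0.
      by apply: he; rewrite -ball_normE /ball_/= gtr0_norm; lra.
    apply/negP; rewrite -leNgt subr_ge0; apply: (le_trans (Ps s _)).
      by rewrite st ltW.
    apply: expect_le; [apply: m2; lra|apply: qw; apply/andP; split; lra|exact: qw|].
    by move=> x; apply: mono => //; exact: ltW.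
have : H t1 <= 12 * S ^+ 6.
  have tt : t0 <= t1 <= t1 by rewrite t01 lexx.
  have T1 : 0 <= t1 <= T by rewrite t1T andbT (le_trans (ltW t00)).
  have := expect_norm_le (rho t1) _ _ (m2 t1 t01) (qw t1 tt).1
    (fun x => abs_well_le _ _ _ x (delta_ge0 t1 tt) (pot_le t1)).
  move=> /(le_trans (ler_norm _)) /le_trans; apply.
  have -> : 12 * S ^+ 6 = (2 * S ^+ 2) ^+ 2 * (3 * S ^+ 2) by ring.
  rewrite ler_pM2l ?exprn_gt0 ?mulr_gt0// ?exprn_gt0//.
  exact: (moment_bound ls flow loss_bound t1 T1).
by move=> /(le_trans key) /(lt_le_trans large); rewrite ltxx.
Qed.

End concentration.

(** * Descent *)

Section descent.
Context {R : realType} {n k : nat} {Rf : 'rV[R]_k -> R}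
  {Phi : 'rV[R]_n -> 'rV[R]_k} {V : 'rV[R]_n -> R} {S : R}.
Hypothesis ls : landscape Rf Phi V S.
Context {U : distr R n}.
Hypothesis unifU : uniform_on_sphere U.
Context {sigma : R} {rho : R -> distr R n}.
Hypothesis sigma_gt0 : 0 < sigma.
Hypothesis flow : perturbed_flow Rf Phi V sigma U rho.

Let S1 : 1 <= S. Proof. exact: ls_S ls. Qed.
Let S0 : 0 < S. Proof. exact: lt_le_trans S1. Qed.

Let pot t := potential (Phi := Phi) (V := V) (grad Rf (meanPhi Phi (rho t))).
Let L t := loss_val (Rf := Rf) (Phi := Phi) (V := V) (rho t).
Let D t := dissipation (Rf := Rf) (Phi := Phi) (V := V) (rho := rho) t.

Hypothesis loss0 : L 0 <= 2 * S.
Context {T : R}.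
Hypothesis loss_bound : forall t, 0 <= t <= T -> L t <= 3 * S.

(* Euler's identity bounds the integral of the potential against [rho t] by the
   dissipation; without a direction of negative potential, convexity then
   bounds the suboptimality. *)
Lemma dissipation_or_descent (mu : distr R n) eps t : 0 < eps -> 0 <= t <= T ->
  moment2 mu -> expect mu (fun x => dot x x) <= 2 * S ^+ 2 ->
  3 / 2 * eps < L t - loss_val (Rf := Rf) (Phi := Phi) (V := V) mu ->
  (exists2 z, sphere R n z & pot t z <= - (eps / (4 * S ^+ 2))) \/
  eps ^+ 2 / S ^+ 2 <= D t.
Proof.
move=> e0 tT m2 mmu gap.
have [[z zS hz]|none] := pselect (exists2 z, sphere R n z & pot t z <= - (eps / (4 * S ^+ 2))).
  by left; exists z.
right; have m2t := moment_flow flow t (proj1 (andP tT)).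
set tau := eps / (4 * S ^+ 2) in none.
have S2 : 0 < S ^+ 2 by rewrite exprn_gt0.
have tau0 : 0 < tau by rewrite divr_gt0// mulr_gt0.
have qp : quadratic (pot t) by exact: (quadratic_potential ls).
have hp : homogeneous2 (pot t : 'rV[R]_n -> R^o) by exact: (hom_potential ls).
have dp x : differentiable (pot t) x by exact: (diff_potential ls).
have low x : - tau * dot x x <= pot t x.
  have [->|x0] := eqVneq x 0; first by rewrite dot0l mulr0 (hom0 _ hp).
  have zS := sphere_normalize x x0; set z := _ *: x in zS.
  have en : enorm x != 0 by rewrite enorm_eq0.
  have -> : x = enorm x *: z by rewrite /z scalerA divff// scale1r.
  rewrite (homE _ hp) dotZl dotZr (sphere_dot _).1// mulr1 -expr2 mulrC.
  rewrite ler_wpM2l ?sqr_ge0// leNgt; apply/negP => /ltW h; apply: none.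
  by exists z.
set M := expect (rho t) (fun x => dot x x).
have M3 : M <= 3 * S ^+ 2 := moment_bound ls flow loss_bound t tT.
(* Chosen so that [nu / 4 * M <= eps / 4]. The gap [3 / 2 * eps] loses this and the [eps / 2] of
   [mu], which leaves [3 / 4 * eps] to the dissipation. *)
pose nu := eps / (3 * S ^+ 2).
have nu0 : 0 < nu by rewrite divr_gt0// mulr_gt0.
have gp x : enorm (grad (pot t) x) <= 5 * S ^+ 3 * enorm x.
  exact: (grad_potential_le ls _ x (force_le ls t)).
have qg := quadratic_grad2 _ _ _ _ dp dp gp gp.
have up : expect (rho t) (pot t) <= nu / 4 * M + (4 * nu)^-1 * D t.
  rewrite /M /D /dissipation -!expectZ//; [|exact: quadratic_norm2].
  rewrite -expectD//; [|by apply: quadraticZ; exact: quadratic_norm2|exact: quadraticZ].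
  apply: expect_le => //.
    by apply: quadraticD; apply: quadraticZ => //; exact: quadratic_norm2.
  move=> x; have := euler_hom _ hp dp x; rewrite diff_grad// dotC => eu.
  have := dot_young x (grad (pot t) x) nu nu0; rewrite eu.
  have -> : nu / 4 * dot x x + (4 * nu)^-1 * dot (grad (pot t) x) (grad (pot t) x) =
    (nu * dot x x + nu^-1 * dot (grad (pot t) x) (grad (pot t) x)) / 2 / 2.
    by field; rewrite gt_eqF.
  by move: (_ / 2) => q; rewrite ler_pdivlMr// mulrC.
have dn : - (eps / 2) <= expect mu (pot t).
  apply: (@le_trans _ _ (- tau * expect mu (fun x => dot x x))).
    rewrite mulNr lerN2; apply: (@le_trans _ _ (tau * (2 * S ^+ 2))).
      by rewrite ler_pM2l.
    by rewrite le_eqVlt; apply/orP; left; apply/eqP; rewrite /tau; field; rewrite gt_eqF.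
  rewrite -expectZ//; last exact: quadratic_norm2.
  by apply: expect_le => //; apply: quadraticZ; exact: quadratic_norm2.
have cvx := loss_convex ls (rho t) mu m2t m2.
have h1 : nu / 4 * M <= eps / 4.
  apply: (@le_trans _ _ (nu / 4 * (3 * S ^+ 2))); first by apply: ler_wpM2l => //; rewrite divr_ge0// ltW.
  by rewrite le_eqVlt; apply/orP; left; apply/eqP; rewrite /nu; field; rewrite gt_eqF.
have h2 : 3 / 4 * eps <= (4 * nu)^-1 * D t.
  move: cvx gap up dn h1; rewrite -/(pot t) -/(L t).
  set q1 := expect (rho t) _; set q2 := expect mu _; set q3 := _ / 4 * M; lra.
have -> : eps ^+ 2 / S ^+ 2 = 4 * nu * (3 / 4 * eps).
  by rewrite /nu; field; rewrite gt_eqF.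
by rewrite -ler_pdivlMl// mulr_gt0.
Qed.

Context {mu : distr R n} {eps T1 : R}.
Let tau := eps / (4 * S ^+ 2).
(** [lam] makes the Young term of the drift over a window [T1] equal to [tau / 24], and [Delta]
    makes the term paid by the loss equal to [tau / 8]. The two noise terms will take at most
    [tau / 24] each, for a total of [tau / 4]. *)
Let lam := tau / (144 * S ^+ 6 * T1).
Let Delta := tau * lam / (16 * S ^+ 4).

Hypothesis eps_gt0 : 0 < eps.
Hypothesis eps_le1 : eps <= 1.
Hypothesis T1_gt0 : 0 < T1.
Hypothesis mu_moment : moment2 mu.
Hypothesis mu_moment_le : expect mu (fun x => dot x x) <= 2 * S ^+ 2.
Hypothesis sigma_le : sigma <= tau.
Hypothesis drift_le : S ^+ 2 * ((4 * sigma * S ^+ 3 + 6 * lam * S ^+ 4 +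
  12 * sigma * S ^+ 6 / lam) * T1 + 2 * S ^+ 2 / lam * Delta) <= tau / 4.
Hypothesis growth_large :
  12 * S ^+ 6 < sigma * ((tau / 8) ^+ 2 * (tau / (256 * S ^+ 3)) ^+ n) / (2 * tau)
                * (expR (tau * T1) - 1).
Hypothesis noise_small : 6 * S ^+ 4 * sigma * T1 <= Delta / 2.
Hypothesis dissipation_large : Delta / 2 <= (eps ^+ 2 / S ^+ 2 - 6 * S ^+ 4 * sigma) * T1.
Hypothesis gap_large : forall t, 0 <= t <= T ->
  3 / 2 * eps < L t - loss_val (Rf := Rf) (Phi := Phi) (V := V) mu.

(** Two windows of length [T1]. If the dissipation is large throughout the first, the energy
    inequality suffices. Otherwise some [u] inside it has a direction of negative potential, and the
    loss falls by [Delta] within [T1] after [u], of which the noise before [u] gives back at most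
    half. Being interior, [u] is positive, as [loss_drops] requires. *)
Lemma descent_step s : 0 <= s -> s + 2 * T1 <= T ->
  exists2 s', s <= s' <= s + 2 * T1 & L s' <= L s - Delta / 2.
Proof.
move=> s0 sT; have T10 := T1_gt0.
have tau0 : 0 < tau by rewrite /tau divr_gt0// mulr_gt0// exprn_gt0.
have lam0 : 0 < lam by rewrite /lam divr_gt0// !mulr_gt0// exprn_gt0.
have [all|/existsNP[u /not_implyP[/andP[su us] /negP]]] :=
  pselect (forall u, s < u < s + T1 -> eps ^+ 2 / S ^+ 2 <= D u).
  exists (s + T1); first by apply/andP; split; lra.
  have sT1 : s <= s + T1 by lra.
  have := loss_decay ls unifU sigma_gt0 flow loss0 s (s + T1) _ s0 sT1 all.
  move=> /le_trans; apply; rewrite -/(L s) (addrC s) addrK.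
  by move: dissipation_large; lra.
rewrite -ltNge => small.
have uT : 0 <= u <= T by apply/andP; split; lra.
have [[z zS hz]|] := dissipation_or_descent mu eps u eps_gt0 uT mu_moment mu_moment_le
   (gap_large u uT); last by rewrite leNgt small.
have tau1 : tau <= 1.
  rewrite /tau ler_pdivrMr ?mulr_gt0 ?exprn_gt0// mul1r.
  have : 1 <= S ^+ 2 by rewrite exprn_ege1.
  by move: eps_le1; lra.
have u0 : 0 < u by lra.
have uu : u <= u + T1 by lra.
have uT1 : u + T1 <= T by lra.
have [||t /andP[t1 t2] ht] := loss_drops ls unifU sigma_gt0 flow loss0 loss_bound z lam tau Delta
  u (u + T1) zS tau0 tau1 u0 uu uT1 lam0 hz sigma_le.
- by rewrite (addrC u) addrK.
- by rewrite (addrC u) addrK.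
exists t; first by apply/andP; split; lra.
have := loss_growth ls unifU sigma_gt0 flow loss0 s u s0 (ltW su).
have : 6 * S ^+ 4 * sigma * (u - s) <= 6 * S ^+ 4 * sigma * T1.
  by rewrite ler_pM2l; [lra|rewrite !mulr_gt0// exprn_gt0].
move: ht noise_small; rewrite -/(L t) -/(L u) -/(L s).
by set q := _ * (u - s); set q' := _ * T1; lra.
Qed.

Lemma descent_iter N : 2 * T1 * N%:R <= T ->
  exists2 s, 0 <= s <= 2 * T1 * N%:R & L s <= L 0 - N%:R * (Delta / 2).
Proof.
have T10 := T1_gt0.
elim: N => [_|N IH].
  by exists 0; rewrite ?mulr0 ?lexx// mul0r subr0.
rewrite -[N.+1%:R]natr1 mulrDr mulr1 => NT.
have [|s /andP[s0 sN] hs] := IH; first by lra.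
have [|s' /andP[ss s's] hs'] := descent_step s s0; first by lra.
exists s'; first by apply/andP; split; lra.
by rewrite mulrDl mul1r; lra.
Qed.

Lemma descent_contradiction N : 2 * T1 * N%:R <= T -> 2 * S < N%:R * (Delta / 2) -> False.
Proof.
move=> /descent_iter[s _ hs] h.
have := loss_val_ge0 ls (rho s); rewrite -/(L s).
by move: hs loss0 h; set q := N%:R * _; lra.
Qed.

End descent.

(** * The choice of the noise level and of the time *)

Lemma ler_factor {R : realFieldType} (f u v : R) : u = f * v -> f <= 1 -> 0 <= v -> u <= v.
Proof. by move=> -> f1 v0; exact: ler_piMl. Qed.

Section schedule.
Context {R : realType} {S eps l l0 : R} {d : nat}.
Hypotheses (S1 : 1 <= S) (eps0 : 0 < eps) (eps1 : eps <= 1) (d0 : (0 < d)%N).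
Hypotheses (l00 : 0 < l0) (l0l : l0 <= l) (epsE : eps^-1 = expR l).

(** Minus the logarithm of the noise level. As [eps] may come close to 1, [l] is only known to be at
    least [l0]; the factor [110 / l0] makes up for it, so that [X >= d (110 S + 8 l)]. *)
Let X := d%:R * l * ((110 / l0 + 8) * S).
Let sigma := expR (- X).

Let d1 : 1 <= d%:R :> R. Proof. by rewrite ler1n. Qed.
Let S0 : 0 < S. Proof. exact: lt_le_trans S1. Qed.
Let lgt0 : 0 < l. Proof. exact: lt_le_trans l0l. Qed.

Lemma exponent_le : d%:R * (110 * S + 8 * l) <= X.
Proof.
rewrite /X -mulrA ler_wpM2l ?ler0n// mulrA mulrDr mulrDl; apply: lerD.
  rewrite ler_wpM2r ?(ltW S0)//.
  have -> : l * (110 / l0) = 110 * (l / l0) by ring.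
  by rewrite -[leLHS]mulr1 ler_pM2l ?ltr0n// ler_pdivlMr// mul1r.
have h : 0 <= 8 * l by rewrite mulr_ge0 ?ler0n ?ltW.
by rewrite -[leLHS]mulr1 (mulrC 8 l) ler_wpM2l// mulrC.
Qed.

Lemma exponent_ge : 110 * S + 8 * l <= X.
Proof.
apply: le_trans exponent_le; rewrite -{1}[110 * S + _]mul1r ler_wpM2r//.
by rewrite addr_ge0// mulr_ge0 ?ler0n// ltW.
Qed.

Lemma exponent_ge1 : 1 <= X.
Proof. by apply: le_trans exponent_ge; move: S1 lgt0; lra. Qed.

Lemma le_expR (x : R) : x <= expR x.
Proof. by apply: le_trans (expR_ge1Dx x); rewrite lerDr. Qed.

Lemma two_le_expR1 : 2 <= expR 1 :> R.
Proof. exact: expR_ge1Dx. Qed.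

(** This fixes 110 and 8: the exponents of the factors add up to [32 + 23 S + 4 l + X / 2], and
    [32 + 23 S + 4 l <= 55 S + 4 l <= X / 2]. *)
Lemma exponent_polynomial : 2 ^+ 28 * (S ^+ 23 * X ^+ 2 / eps ^+ 4) <= expR X.
Proof.
have X1 := exponent_ge1; have XS := exponent_ge.
have h1 : 2 ^+ 28 <= expR (28%:R * 1) :> R.
  by rewrite expRM_natl lerXn2r ?nnegrE ?expR_ge0 ?two_le_expR1.
have h2 : S ^+ 23 <= expR (23%:R * S).
  by rewrite expRM_natl lerXn2r ?nnegrE ?expR_ge0 ?le_expR// ltW.
have h3 : X ^+ 2 <= expR (4%:R * 1 + X / 2).
  rewrite expRD expRM_natl.
  have -> : X / 2 = 2%:R * (X / 4) by field.
  rewrite expRM_natl; have -> : X = 4 * (X / 4) by field.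
  have -> : 4 * (X / 4) / 4 = X / 4 by field.
  rewrite exprMn; apply: ler_pM; rewrite ?sqr_ge0//.
    rewrite (_ : 4 ^+ 2 = 2 ^+ 4); last by ring.
    by rewrite lerXn2r ?nnegrE ?expR_ge0 ?two_le_expR1.
  rewrite lerXn2r ?nnegrE ?expR_ge0 ?le_expR//.
  by rewrite divr_ge0// (le_trans _ X1).
have h4 : (eps ^+ 4)^-1 = expR (4%:R * l) by rewrite expRM_natl -epsE exprVn.
have X0 : 0 <= X by exact: le_trans X1.
apply: (@le_trans _ _ (expR (28%:R * 1) * (expR (23%:R * S) * expR (4%:R * 1 + X / 2)
   * expR (4%:R * l)))).
  rewrite h4; apply: ler_pM => //.
    by rewrite mulr_ge0 ?invr_ge0 ?exprn_ge0 ?(ltW eps0)// mulr_ge0 ?exprn_ge0 ?(ltW S0).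
  rewrite ler_wpM2r ?expR_ge0//; apply: ler_pM => //.
    by rewrite exprn_ge0 ?(ltW S0).
  exact: exprn_ge0.
by rewrite -!expRD ler_expR; move: XS S1; lra.
Qed.

(** [2 ^ 10 S ^ 5 / eps] is the reciprocal of the cap factor [tau / (256 S ^ 3)]; the power [5 d]
    covers the exponent [d + 4] met below, as [1 <= d]. *)
Lemma exponent_cap : (2 ^+ 10 * S ^+ 5 / eps) ^+ (5 * d) <= expR X.
Proof.
have h1 : 2 ^+ 10 * S ^+ 5 / eps <= expR (10%:R * 1 + 5%:R * S + l).
  rewrite !expRD -epsE !expRM_natl ler_wpM2r ?invr_ge0 ?(ltW eps0)//.
  by apply: ler_pM; rewrite ?exprn_ge0 ?(ltW S0)// lerXn2r ?nnegrE ?expR_ge0 ?two_le_expR1 ?le_expR// ltW.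
apply: (@le_trans _ _ (expR (10%:R * 1 + 5%:R * S + l) ^+ (5 * d))).
  rewrite lerXn2r ?nnegrE ?expR_ge0// mulr_ge0 ?invr_ge0 ?(ltW eps0)//.
  by rewrite mulr_ge0 ?exprn_ge0 ?(ltW S0).
rewrite -expRM_natl ler_expR natrM; apply: le_trans exponent_le.
rewrite [5%:R * _]mulrC -mulrA ler_wpM2l ?ler0n//.
by move: S1 lgt0; lra.
Qed.

Let sigma_gt0 : 0 < sigma. Proof. exact: expR_gt0. Qed.

(** Every smallness condition on the noise reduces to such a monomial up to a coefficient; 23, 2 and
    4 are the largest exponents that occur. *)
Lemma noise_monomial a b c : (a <= 23)%N -> (b <= 2)%N -> (c <= 4)%N ->
  2 ^+ 19 * (sigma * (S ^+ a * X ^+ b / eps ^+ c)) <= 1 / 2 ^+ 9.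
Proof.
move=> ha hb hc; have X1 := exponent_ge1; have X0 : 0 <= X by exact: le_trans X1.
have e1 : 1 <= eps^-1 by rewrite invf_ge1.
rewrite ler_pdivlMr ?exprn_gt0//.
have -> : 2 ^+ 19 * (sigma * (S ^+ a * X ^+ b / eps ^+ c)) * 2 ^+ 9 =
  2 ^+ 28 * (S ^+ a * X ^+ b * eps^-1 ^+ c) * sigma by rewrite exprVn; ring.
rewrite /sigma expRN ler_pdivrMr ?expR_gt0// mul1r.
apply: le_trans exponent_polynomial; rewrite ler_wpM2l ?exprn_ge0// -exprVn.
have eV0 : 0 <= eps^-1 by exact: le_trans e1.
apply: ler_pM; rewrite ?mulr_ge0 ?exprn_ge0 ?(ltW S0)//; last exact: ler_weXn2l.
by apply: ler_pM; rewrite ?exprn_ge0 ?(ltW S0)//; exact: ler_weXn2l.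
Qed.

Let tau := eps / (4 * S ^+ 2).
Let T1 := 2 * X / tau.
Let lam := tau / (144 * S ^+ 6 * T1).
Let Delta := tau * lam / (16 * S ^+ 4).
(** Room for [4 S / Delta + 1] drops, each taking [2 T1]: the leading term has coefficient
    [9 * 2 ^ 21], and [7 * 2 ^ 21] is left for the rest. *)
Let T := 2 ^+ 25 * S ^+ 19 * X ^+ 2 / eps ^+ 4.

Let X0 : 0 < X. Proof. exact: lt_le_trans exponent_ge1. Qed.
Let S_neq0 : S != 0. Proof. by rewrite gt_eqF. Qed.
Let eps_neq0 : eps != 0. Proof. by rewrite gt_eqF. Qed.
Let X_neq0 : X != 0. Proof. by rewrite gt_eqF. Qed.

Lemma noise_small c' a b c : (a <= 23)%N -> (b <= 2)%N -> (c <= 4)%N ->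
  0 <= c' -> c' <= 500 * 2 ^+ 19 -> c' * (sigma * (S ^+ a * X ^+ b / eps ^+ c)) <= 1.
Proof.
move=> ha hb hc c0 c500; have := noise_monomial a b c ha hb hc.
set m := sigma * _ => hm.
have m0 : 0 <= m.
  rewrite /m mulr_ge0 ?(ltW sigma_gt0)// mulr_ge0 ?invr_ge0 ?exprn_ge0 ?(ltW eps0)//.
  by rewrite mulr_ge0 ?exprn_ge0 ?(ltW S0) ?(ltW X0).
apply: (@le_trans _ _ (500 * (2 ^+ 19 * m))); first by rewrite mulrA ler_wpM2r.
apply: (@le_trans _ _ (500 * (1 / 2 ^+ 9))); first by rewrite ler_pM2l ?ltr0n.
rewrite mul1r ler_pdivrMr ?exprn_gt0// mul1r (_ : 2 ^+ 9 = 512); [lra|ring].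
Qed.

Let t19 : 16 <= 2 ^+ 19 :> R.
Proof.
rewrite (_ : 2 ^+ 19 = 16 * 2 ^+ 15 :> R); last by ring.
by rewrite ler_peMr ?ler0n// exprn_ege1// ler1n.
Qed.

Lemma tau_gt0 : 0 < tau.
Proof. by rewrite divr_gt0// mulr_gt0 ?ltr0n// exprn_gt0. Qed.

Lemma T1_gt0 : 0 < T1.
Proof. by rewrite divr_gt0 ?tau_gt0// mulr_gt0. Qed.

Lemma T1E : T1 = 8 * X * S ^+ 2 / eps.
Proof. by rewrite /T1 /tau; field; rewrite S_neq0 eps_neq0. Qed.

Lemma lamE : lam = eps ^+ 2 / (2 ^+ 9 * 9 * S ^+ 10 * X).
Proof. by rewrite /lam T1E /tau; field; rewrite S_neq0 eps_neq0 X_neq0. Qed.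

Lemma DeltaE : Delta = eps ^+ 3 / (2 ^+ 15 * 9 * S ^+ 16 * X).
Proof. by rewrite /Delta lamE /tau; field; rewrite S_neq0 X_neq0. Qed.

Lemma lam_gt0 : 0 < lam.
Proof.
apply: divr_gt0; first exact: tau_gt0.
by apply: mulr_gt0; [rewrite mulr_gt0 ?ltr0n ?exprn_gt0|exact: T1_gt0].
Qed.

Lemma Delta_gt0 : 0 < Delta.
Proof.
apply: divr_gt0; first by rewrite mulr_gt0 ?tau_gt0 ?lam_gt0.
by rewrite mulr_gt0 ?ltr0n ?exprn_gt0.
Qed.

Lemma schedule_noise_le : sigma <= tau.
Proof.
have := noise_small 4 2 0 1 isT isT isT; rewrite ler0n => /(_ isT) h.
apply: ler_factor (h _) (ltW tau_gt0); last by move: t19; lra.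
by rewrite /tau; field; rewrite S_neq0 eps_neq0.
Qed.

Lemma schedule_growth_le : 6 * S ^+ 4 * sigma * T <= 1.
Proof.
have h := noise_small (6 * 2 ^+ 25) 23 2 4 isT isT isT.
have -> : 6 * S ^+ 4 * sigma * T = 6 * 2 ^+ 25 * (sigma * (S ^+ 23 * X ^+ 2 / eps ^+ 4)).
  by rewrite /T; field.
apply: h; first by rewrite mulr_ge0 ?ler0n ?exprn_ge0.
rewrite (_ : 2 ^+ 25 = 64 * 2 ^+ 19 :> R); last by ring.
by move: t19; lra.
Qed.

Lemma schedule_noise_small : 6 * S ^+ 4 * sigma * T1 <= Delta / 2.
Proof.
have h := noise_small (54 * 2 ^+ 19) 22 2 4 isT isT isT.
apply: ler_factor (h _ _) _.
- by rewrite T1E DeltaE; field; rewrite S_neq0 eps_neq0 X_neq0.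
- by rewrite mulr_ge0 ?ler0n ?exprn_ge0.
- by move: t19; lra.
- by rewrite divr_ge0 ?(ltW Delta_gt0).
Qed.

Lemma schedule_drift_le : S ^+ 2 * ((4 * sigma * S ^+ 3 + 6 * lam * S ^+ 4 +
  12 * sigma * S ^+ 6 / lam) * T1 + 2 * S ^+ 2 / lam * Delta) <= tau / 4.
Proof.
have t0 : 0 <= tau / 24 by rewrite divr_ge0 ?(ltW tau_gt0).
have k1 : 4 * sigma * S ^+ 5 * T1 <= tau / 24.
  have h := noise_small (96 * 32) 9 1 2 isT isT isT.
  apply: ler_factor (h _ _) t0.
  - by rewrite T1E /tau; field; rewrite S_neq0 eps_neq0.
  - by rewrite mulr_ge0 ?ler0n.
  - by move: t19; lra.
have k2 : 12 * sigma * S ^+ 8 / lam * T1 <= tau / 24.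
  have h := noise_small (81 * 2 ^+ 19) 22 2 4 isT isT isT.
  apply: ler_factor (h _ _) t0.
  - by rewrite T1E lamE /tau; field; rewrite S_neq0 eps_neq0 X_neq0.
  - by rewrite mulr_ge0 ?ler0n ?exprn_ge0.
  - by move: t19; lra.
have lam_neq0 : lam != 0 by rewrite gt_eqF ?lam_gt0.
have T1_neq0 : T1 != 0 by rewrite gt_eqF ?T1_gt0.
have -> : S ^+ 2 * ((4 * sigma * S ^+ 3 + 6 * lam * S ^+ 4 +
  12 * sigma * S ^+ 6 / lam) * T1 + 2 * S ^+ 2 / lam * Delta) =
  4 * sigma * S ^+ 5 * T1 + 6 * S ^+ 6 * (lam * T1) + 12 * sigma * S ^+ 8 / lam * T1 +
   2 * S ^+ 4 * (Delta / lam) by field.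
have -> : lam * T1 = tau / (144 * S ^+ 6) by rewrite /lam; field; rewrite S_neq0.
have -> : Delta / lam = tau / (16 * S ^+ 4) by rewrite /Delta; field; rewrite S_neq0.
have -> : 6 * S ^+ 6 * (tau / (144 * S ^+ 6)) = tau / 24 by field.
have -> : 2 * S ^+ 4 * (tau / (16 * S ^+ 4)) = tau / 8 by field.
by move: k1 k2; lra.
Qed.

Lemma schedule_dissipation_large :
  Delta / 2 <= (eps ^+ 2 / S ^+ 2 - 6 * S ^+ 4 * sigma) * T1.
Proof.
rewrite mulrBl lerBrDr.
apply: (@le_trans _ _ (Delta / 2 + Delta / 2)); first by rewrite lerD2l schedule_noise_small.
rewrite -splitr.
have -> : eps ^+ 2 / S ^+ 2 * T1 = 8 * X * eps by rewrite T1E; field; rewrite S_neq0 eps_neq0.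
have X1 := exponent_ge1.
apply: (@le_trans _ _ eps); last by rewrite ler_peMl ?(ltW eps0)//; move: X1; lra.
have c0 : 0 < 2 ^+ 15 * 9 :> R by rewrite mulr_gt0 ?exprn_gt0 ?ltr0n.
have den := mulr_gt0 (mulr_gt0 c0 (exprn_gt0 16 S0)) X0.
rewrite DeltaE (ler_pdivrMr _ _ den).
apply: (@le_trans _ _ (eps * 1)).
  by rewrite mulr1 -[leRHS]expr1 ler_wiXn2l ?(ltW eps0).
rewrite ler_pM2l//; apply: mulr_ege1 => //; apply: mulr_ege1; [lra|exact: exprn_ege1].
Qed.

Lemma schedule_growth_large :
  12 * S ^+ 6 < sigma * ((tau / 8) ^+ 2 * (tau / (256 * S ^+ 3)) ^+ d.+1) / (2 * tau)
                * (expR (tau * T1) - 1).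
Proof.
(* With [E = 1 / sigma], and after division by [S ^ 6], the claim reads
   [12 tau Q ^ (d + 3) < 2 ^ 9 (E - 1 / E)]; it follows from [4 Q ^ (d + 3) <= Q ^ (d + 4) <= E]. *)
set Q := 2 ^+ 10 * S ^+ 5 / eps; set E := expR X.
have t0 := tau_gt0; have E0 : 0 < E := expR_gt0 X.
have V1 : 1 <= eps^-1 by rewrite invf_ge1.
have S5 : 1 <= S ^+ 5 by rewrite exprn_ege1.
have Q4 : 4 <= Q.
  have p10 : 2 ^+ 2 <= 2 ^+ 10 :> R by apply: ler_weXn2l => //; rewrite ler1n.
  apply: (@le_trans _ _ (2 ^+ 2)); first by rewrite expr2; lra.
  rewrite /Q -mulrA; apply: (le_trans p10).
  by rewrite ler_peMr ?exprn_ge0// mulr_ege1.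
have Q1 : 1 <= Q by move: Q4; lra.
have Q0 : 0 < Q by exact: lt_le_trans Q1.
have e1 : tau / (256 * S ^+ 3) = Q^-1.
  by rewrite /tau /Q; field; rewrite S_neq0 eps_neq0.
have e2 : tau / 8 = 32 * S ^+ 3 / Q.
  by rewrite /tau /Q; field; rewrite S_neq0 eps_neq0.
have e3 : tau * T1 = X + X by rewrite /T1; field; rewrite gt_eqF.
have sE : sigma = E^-1 by rewrite /sigma expRN.
have tau4 : tau <= 1 / 4.
  rewrite /tau ler_pdivrMr ?mulr_gt0 ?ltr0n ?exprn_gt0//.
  by have : 1 <= S ^+ 2 by [rewrite exprn_ege1]; move: eps1; lra.
rewrite e1 e2 e3 expRD -/E sE.
have -> : E^-1 * ((32 * S ^+ 3 / Q) ^+ 2 * Q^-1 ^+ d.+1) / (2 * tau) * (E * E - 1) =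
  (E - E^-1) * (2 ^+ 9 * S ^+ 6) / (Q ^+ d.+3 * tau).
  rewrite exprVn !exprS; field.
  by rewrite !gt_eqF ?exprn_gt0.
rewrite ltr_pdivlMr; last exact: (mulr_gt0 (exprn_gt0 _ Q0) t0).
have EQ : Q ^+ d.+4 <= E.
  apply: le_trans exponent_cap; apply: ler_weXn2l => //.
  by rewrite -[d.+4]addn4 (mulSn 4) leq_add2l leq_pmulr.
have EV : E^-1 <= 1 by rewrite invf_le1//; apply: le_trans EQ; rewrite exprn_ege1.
have Qd : 1 <= Q ^+ d.+3 by rewrite exprn_ege1.
have -> : 12 * S ^+ 6 * (Q ^+ d.+3 * tau) = S ^+ 6 * (12 * tau * Q ^+ d.+3) by ring.
have -> : (E - E^-1) * (2 ^+ 9 * S ^+ 6) = S ^+ 6 * (2 ^+ 9 * (E - E^-1)) by ring.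
rewrite ltr_pM2l ?exprn_gt0//.
have h1 : 12 * tau * Q ^+ d.+3 <= 3 * Q ^+ d.+3.
  by rewrite ler_wpM2r ?(le_trans _ Qd)//; lra.
have h2 : 4 * Q ^+ d.+3 <= E.
  by apply: le_trans EQ; rewrite (exprS Q d.+3) ler_wpM2r ?(le_trans _ Qd).
apply: (@lt_le_trans _ _ (2 * (E - E^-1))).
  by move: h1 h2 EV Qd; set q := Q ^+ _; set q' := E^-1; lra.
have p9 : 2 ^+ 1 <= 2 ^+ 9 :> R by apply: ler_weXn2l => //; rewrite ler1n.
apply: ler_wpM2r; last exact: p9.
rewrite subr_ge0; apply: (le_trans EV).
by apply: le_trans EQ; rewrite exprn_ege1.
Qed.

Lemma schedule_time : 2 * T1 * (4 * S / Delta + 1) <= T.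
Proof.
have X1 := exponent_ge1.
have -> : 2 * T1 * (4 * S / Delta + 1) = 9 * 2 ^+ 21 * (S ^+ 19 * X ^+ 2 / eps ^+ 4)
    + 16 * (S ^+ 2 * X ^+ 1 / eps ^+ 1).
  by rewrite T1E DeltaE; field; rewrite S_neq0 eps_neq0 X_neq0.
have -> : T = 9 * 2 ^+ 21 * (S ^+ 19 * X ^+ 2 / eps ^+ 4) +
    7 * 2 ^+ 21 * (S ^+ 19 * X ^+ 2 / eps ^+ 4) by rewrite /T; field.
have e1 : 1 <= eps^-1 by rewrite invf_ge1.
have eV0 : 0 <= eps^-1 by exact: le_trans e1.
rewrite lerD2l; apply: ler_pM => //.
- rewrite mulr_ge0 ?invr_ge0 ?exprn_ge0 ?(ltW eps0)//.
  by rewrite mulr_ge0 ?exprn_ge0 ?(ltW S0) ?(ltW X0).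
- rewrite (_ : 2 ^+ 21 = 4 * 2 ^+ 19 :> R); last by ring.
  by move: t19; lra.
have hS m : 0 <= S ^+ m by rewrite exprn_ge0 ?(ltW S0).
have hX m : 0 <= X ^+ m by rewrite exprn_ge0 ?(ltW X0).
rewrite -!exprVn; apply: ler_pM.
- exact: (mulr_ge0 (hS 2) (hX 1)).
- exact: exprn_ge0.
- by apply: ler_pM => //; exact: ler_weXn2l.
- exact: ler_weXn2l.
Qed.

End schedule.

(** * Evaluation of the two polynomials and final assembly *)

Definition mvar {R : realType} {m : nat} (i : 'I_m) : mpoly.mpoly m R :=
  mpoly.mpolyX R (mpoly.mnm1 i).

Lemma poly_at_scaled_norm {R : realType} (m : nat) (c : R) (s : seq R) :
  poly_at (c *: (1 + \sum_(i < m) mvar i ^+ 2)) s = c * (1 + \sum_(i < m) s`_i ^+ 2).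
Proof.
rewrite /poly_at mpoly.mevalZ mpoly.mevalD mpoly.meval1 raddf_sum; congr (_ * (_ + _)).
by apply: eq_bigr => i _; rewrite /= expr2 mpoly.mevalM mpoly.mevalXU.
Qed.

Lemma poly_at_time {R : realType} (c : R) (l : R) (s : seq R) :
  poly_at (c *: (mvar ord0 ^+ 2 * (1 + \sum_(i < 11) mvar (lift ord0 i) ^+ 2) ^+ 21)) (l :: s) =
  c * (l ^+ 2 * (1 + \sum_(i < 11) s`_i ^+ 2) ^+ 21).
Proof.
rewrite /poly_at mpoly.mevalZ mpoly.mevalM !rmorphXn/= mpoly.mevalXU; congr (_ * (_ * _ ^+ _)).
rewrite mpoly.mevalD mpoly.meval1 raddf_sum; congr (_ + _).
by apply: eq_bigr => i _; rewrite /= expr2 mpoly.mevalM mpoly.mevalXU.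
Qed.

(** Explains the exponents of the time polynomial: of [S ^ 21], 19 come from the horizon and 2, like
    [l ^ 2], from the square of [X]. *)
Lemma time_factor {F : fieldType} (a c d e l S : F) :
  d ^+ 2 / e ^+ 4 * (a * c ^+ 2 * (l ^+ 2 * S ^+ 21)) =
  a * S ^+ 19 * (d * l * (c * S)) ^+ 2 / e ^+ 4.
Proof. by ring. Qed.

Theorem theoremE4 (R : realType) (eps0 : R) (eps0_gt0 : 0 < eps0)
    (eps0_lt1 : eps0 < 1) :
  exists (P : mpoly.mpoly 11 R) (Q : mpoly.mpoly 12 R),
  forall (d k : nat), (0 < d)%N ->
  forall (Rf : 'rV[R]_k -> R) (Phi : 'rV[R]_d.+1 -> 'rV[R]_k)
    (V : 'rV[R]_d.+1 -> R) (M_R C_R B_Phi M_Phi b_V B_V M_V : R),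
  homogeneous2 Phi ->
  homogeneous2 (V : 'rV[R]_d.+1 -> R^o) ->
  regularity Rf Phi V M_R C_R B_Phi M_Phi b_V B_V M_V ->
  forall (U : distr R d.+1), uniform_on_sphere U ->
  forall (eps : R), 0 < eps -> eps <= eps0 ->
  forall (rho : R -> distr R d.+1),
  let Lstar := loss_inf Rf Phi V in
  let gap := fine (loss Rf Phi V (rho 0%R) - Lstar)%E in
  let args := [:: k%:R; M_V; M_R; M_Phi; b_V; B_V; C_R; B_Phi; gap;
                  b_V^-1; fine Lstar] in
  let sigma := expR (- (d%:R * ln (1 / eps) * poly_at P args)) in
  let t_eps := d%:R ^+ 2 / eps ^+ 4 * poly_at Q (ln (1 / eps) :: args) in
  perturbed_flow Rf Phi V sigma U rho ->
  exists t0 : R,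
    [/\ 0 <= t0 <= t_eps,
        forall t : R, 0 <= t <= t_eps ->
          (loss Rf Phi V (rho t0) <= loss Rf Phi V (rho t))%E &
        (loss Rf Phi V (rho t0) - Lstar <= (2 * eps)%:E)%E].
Proof.
(* Both polynomials are fixed before [eps]; they depend on [eps0] only through the lower bound [l0]
   on [ln (1 / eps)]. *)
set l0 := ln (1 / eps0); set c := 110 / l0 + 8.
exists (c *: (1 + \sum_(i < 11) mvar i ^+ 2)).
exists ((2 ^+ 25 * c ^+ 2) *:
  (mvar ord0 ^+ 2 * (1 + \sum_(i < 11) mvar (lift ord0 i) ^+ 2) ^+ 21)).
move=> d k d0 Rf Phi V M_R C_R B_Phi M_Phi b_V B_V M_V hPhi hV reg U unifU eps e0 ee0 rho.
move=> Lstar gap args sigma t_eps flow.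
pose l := ln (1 / eps).
(* A polynomial in the arguments that dominates each of them, whatever its sign, since
   [x <= 1 + x ^ 2]. *)
set S := 1 + \sum_(i < 11) args`_i ^+ 2.
have le_S (i : 'I_11) : args`_i <= S.
  apply: (@le_trans _ _ (1 + args`_i ^+ 2)).
    by have := sqr_ge0 (args`_i - 1); rewrite sqrrB1 mulr2n; have := sqr_ge0 (args`_i); lra.
  rewrite lerD2l (bigD1 i)//= lerDl sumr_ge0// => j _; exact: sqr_ge0.
have S1 : 1 <= S by rewrite lerDl sumr_ge0// => j _; exact: sqr_ge0.
have S0 : 0 < S by exact: lt_le_trans S1.
have ls : landscape Rf Phi V S.
  apply: (regularity_landscape Rf Phi V M_R C_R B_Phi M_Phi b_V B_V M_V S hPhi hV reg S1).
  - exact: (le_S (@Ordinal 11 0 isT)).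
  - exact: (le_S (@Ordinal 11 2 isT)).
  - exact: (le_S (@Ordinal 11 6 isT)).
  - exact: (le_S (@Ordinal 11 7 isT)).
  - exact: (le_S (@Ordinal 11 3 isT)).
  - exact: (le_S (@Ordinal 11 9 isT)).
  - exact: (le_S (@Ordinal 11 5 isT)).
  - exact: (le_S (@Ordinal 11 1 isT)).
have l00 : 0 < l0 by rewrite ln_gt0// div1r invf_gt1.
have eps_le1 : eps <= 1 by exact: le_trans ee0 (ltW eps0_lt1).
have l0l : l0 <= l by rewrite ler_ln ?posrE ?divr_gt0// !div1r lef_pV2.
have epsE : eps^-1 = expR l by rewrite /l div1r lnK// posrE invr_gt0.
pose X := d%:R * l * (c * S).
have sigmaE : sigma = expR (- X) by rewrite /sigma poly_at_scaled_norm.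
pose T := 2 ^+ 25 * S ^+ 19 * X ^+ 2 / eps ^+ 4.
have TE : t_eps = T.
  rewrite /t_eps poly_at_time -/S /T /X; exact: time_factor.
rewrite {}sigmaE {sigma} in flow; rewrite {}TE {t_eps}.
have sigma_gt0 : 0 < expR (- X) by exact: expR_gt0.
have m2 t : 0 <= t -> moment2 (rho t) by exact: moment_flow flow t.
have LE t : 0 <= t -> loss Rf Phi V (rho t) = (loss_val (Rf := Rf) (Phi := Phi) (V := V) (rho t))%:E.
  by move=> t0; apply: (lossE ls); exact: m2.
pose L t := loss_val (Rf := Rf) (Phi := Phi) (V := V) (rho t).
have L0 t : 0 <= L t by exact: (loss_val_ge0 ls).
have Lstar0 : (0 <= Lstar)%E.
  apply: le_ereal_inf_tmp => _ [mu _ <-]; rewrite /loss adde_ge0//.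
    by rewrite lee_fin; exact: ls_ge0 ls _.
  by apply: integral_ge0 => x _; rewrite lee_fin; exact: (V_ge0 ls).
have LstarL : (Lstar <= (L 0)%:E)%E.
  by rewrite -LE//; apply: ereal_inf_lbound; exists (rho 0).
have Lfin : Lstar \is a fin_num.
  by rewrite ge0_fin_numE//; apply: le_lt_trans LstarL (ltry _).
pose ell := fine Lstar; have ellE : Lstar = ell%:E by rewrite fineK.
have gapE : gap = L 0 - ell by rewrite /gap LE// ellE -EFinB.
have ellS : ell <= S by exact: (le_S (@Ordinal 11 10 isT)).
have gapS : gap <= S by exact: (le_S (@Ordinal 11 8 isT)).
(* The arguments [gap] and [fine Lstar] add up to the initial loss. *)
have loss0 : L 0 <= 2 * S by move: gapS ellS; rewrite gapE; lra.
have X0 : 0 < X.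
  apply: lt_le_trans (exponent_ge1 S1 d0 l00 l0l).
  exact: ltr01.
have T0 : 0 <= T.
  rewrite /T mulr_ge0 ?invr_ge0 ?exprn_ge0 ?(ltW e0)// mulr_ge0 ?exprn_ge0 ?(ltW X0)//.
  by rewrite mulr_ge0 ?exprn_ge0 ?(ltW S0).
(* Up to time [T] the noise adds at most 1 to the loss, and [1 <= S]. *)
have loss_bound t : 0 <= t <= T -> L t <= 3 * S.
  move=> /andP[t0 tT].
  have := loss_growth ls unifU sigma_gt0 flow loss0 0 t (lexx 0) t0.
  rewrite subr0 => /le_trans; apply.
  have h : 6 * S ^+ 4 * expR (- X) * t <= 1.
    apply: le_trans (schedule_growth_le S1 e0 eps_le1 d0 l00 l0l epsE).
    by rewrite ler_wpM2l// !mulr_ge0 ?exprn_ge0 ?expR_ge0 ?(ltW S0) ?ler0n.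
  by move: loss0 S1 h; rewrite /L; lra.
have cL := loss_continuous ls flow 0 T (lexx 0).
(* The minimum is attained because the loss is continuous in time; a gap above [2 eps] at [t0] then
   holds on all of [[0, T]]. *)
have [t0] := EVT_min T0 cL; rewrite in_itv/= => t0T t0min.
exists t0; split => //.
  move=> t /andP[ta tb]; rewrite !LE ?lee_fin//; last by case/andP: t0T.
  by apply: t0min; rewrite in_itv/= ta.
rewrite LE; last by case/andP: t0T.
rewrite ellE -EFinB lee_fin leNgt; apply/negP => gap_t0.
have gap_all t : 0 <= t <= T -> 2 * eps < L t - ell.
  move=> tT; apply: (lt_le_trans gap_t0); rewrite lerB//.
  by apply: t0min; rewrite in_itv.
(* The infimum need not be attained; a competitor within [eps / 2] of it still leaves a gap of
   [3 / 2 * eps]. *)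
have eps2 : (0 < eps / 2)%R by rewrite divr_gt0.
have [_ [mu _ <-] hmu] := lb_ereal_inf_adherent eps2 Lfin.
have mu2 : moment2 mu.
  apply: (moment2_of_loss ls); apply: lt_trans hmu _.
  by rewrite -/(loss_inf _ _ _) -/Lstar ellE -EFinD ltry.
have hmu' : loss_val (Rf := Rf) (Phi := Phi) (V := V) mu < ell + eps / 2.
  move: hmu; rewrite -/(loss_inf _ _ _) -/Lstar ellE -EFinD (lossE ls)//.
have mmu : expect mu (fun x => dot x x) <= 2 * S ^+ 2.
  apply: (le_trans (moment_le_loss ls _ mu2)).
  have -> : 2 * S ^+ 2 = S * (2 * S) by ring.
  by rewrite ler_pM2l//; move: hmu' ellS S1 eps_le1; lra.
pose tau := eps / (4 * S ^+ 2).
pose T1 := 2 * X / tau.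
pose Delta := tau * (tau / (144 * S ^+ 6 * T1)) / (16 * S ^+ 4).
have T10 : 0 < T1 by exact: (T1_gt0 S1 e0 d0 l00 l0l).
have D0 : 0 < Delta by exact: (Delta_gt0 S1 e0 d0 l00 l0l).
(* [N] must exceed [4 S / Delta] for the contradiction and be at most [4 S / Delta + 1] to fit in
   [T]; truncating and adding one does both. *)
pose N := (Num.truncn (4 * S / Delta)).+1.
have /andP[N1 N2] : (Num.truncn (4 * S / Delta))%:R <= 4 * S / Delta < N%:R.
  by apply: truncn_itv; rewrite divr_ge0 ?(ltW D0)// mulr_ge0 ?(ltW S0) ?ler0n.
apply: (descent_contradiction ls unifU sigma_gt0 flow loss0 loss_bound (mu := mu)
  (eps := eps) (T1 := T1) e0 eps_le1 T10 mu2 mmu _ _ _ _ _ _ N).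
- exact: (schedule_noise_le S1 e0 eps_le1 d0 l00 l0l epsE).
- exact: (schedule_drift_le S1 e0 eps_le1 d0 l00 l0l epsE).
- exact: (schedule_growth_large S1 e0 eps_le1 d0 l00 l0l epsE).
- exact: (schedule_noise_small S1 e0 eps_le1 d0 l00 l0l epsE).
- exact: (schedule_dissipation_large S1 e0 eps_le1 d0 l00 l0l epsE).
- by move=> t tT; have := gap_all t tT; rewrite -/(L t); move: hmu'; lra.
- apply: le_trans (schedule_time S1 e0 eps_le1 d0 l00 l0l).
  rewrite -/tau -/T1 -/Delta; apply: ler_wpM2l; first by rewrite mulr_ge0 ?(ltW T10).
  by apply: (le_trans _ (lerD N1 (lexx 1))); rewrite natr1.
rewrite -[_ < _]/(2 * S < N%:R * (Delta / 2)) mulrA ltr_pdivlMr//.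
by move: N2; rewrite ltr_pdivrMr//; lra.
Qed.
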